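(* The following functions of $x>0$ belong to the set $\mathcal{S}$ of Stieltjes functions: (a) $\dfrac{1}{c+W(x)}$, for $c\ge 0$; (b) $W^\alpha(1/x)$, for $0\le\alpha\le 1$; (c) $x^\beta W^\beta(1/x)$, for $-1\le\beta\le 0$; (d) $\dfrac{W(x)}{x(c+W(x))}$, for $c\ge 0$; (e) $\dfrac{1}{W(x)}-\dfrac1x$; (f) $c+W(x^\beta)$, for $c\ge 0$, $-1\le\beta\le 0$; (g) $\dfrac{1}{c+W(x^\alpha)}$, for $c\ge0$, $0\le\alpha\le1$; (h) $x^{\alpha\beta\gamma}\,W^{-\alpha\gamma}(x^\beta)\,[1+W(x^\beta)]^{1-\gamma}$, for $0\le\alpha\le1$, $-1\le\beta\le0$, $0\le\gamma\le1$; (i) $\dfrac{1}{c+x^\alpha}$, for $0\le\alpha\le1$, $c\ge0$; (j) $1-x^\alpha W^\alpha(1/x)$, for $0\le\alpha\le1$; (k) $1-x^{-\alpha\beta}\,W^{\alpha}(x^\beta)\,[1+W(x^\beta)]^{-\alpha}$, for $0\le\alpha\le1$, $-1\le\beta\le0$.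
   Context: $W$ denotes the principal branch of the Lambert $W$ function; for $x>0$, $W(x)$ is the unique positive real number with $W(x)e^{W(x)}=x$. $W^\alpha(y)$ means $(W(y))^\alpha$. A function $f:(0,\infty)\to\mathbb{R}$ is a Stieltjes function if $f(x)=a+\int_0^\infty\frac{d\mu(t)}{x+t}$ for all $x>0$, where $a\ge 0$ is a constant and $\mu$ is a positive measure on $[0,\infty)$ with $\int_0^\infty(1+t)^{-1}d\mu(t)<\infty$. $\mathcal{S}$ denotes the set of all Stieltjes functions. *)

(* Defs.v *)
From mathcomp Require Import all_boot all_order all_algebra.
From mathcomp Require Import all_classical all_reals all_analysis.
Import Order.TTheory GRing.Theory Num.Theory.
Import numFieldNormedType.Exports.

Set Implicit Arguments.
Unset Strict Implicit.
Unset Printing Implicit Defensive.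

Local Open Scope classical_set_scope.
Local Open Scope ring_scope.

(* The principal branch of the Lambert W function on the half-line x > 0;
   for x <= 0 the value is the junk value 0. *)
Definition lambertW (R : realType) (x : R) : R :=
  xget 0 [set w : R | 0 < w /\ w * expR w = x].

Lemma lambertW_exists (R : realType) (x : R) :
  0 < x -> exists w : R, 0 < w /\ w * expR w = x.
Proof.
move=> x0.
have cf : {within `[0, x], continuous (fun w : R => w * expR w)}.
  apply: continuous_subspaceT => w.
  by apply: cvgM; [exact: cvg_id | exact: continuous_expR].
have xle : x <= x * expR x by rewrite ler_pMr // -expR0 ler_expR ltW.
have [|w w0x wE] := IVT (ltW x0) cf (v := x).
  by rewrite mul0r ge_min le_max (ltW x0) xle orbT.
exists w; split => //.
move: w0x; rewrite in_itv/= => /andP[w0 _].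
rewrite lt_neqAle w0 andbT eq_sym; apply/eqP => w_eq0.
by move: wE x0; rewrite w_eq0 mul0r => <-; rewrite ltxx.
Qed.

Lemma lambertWP (R : realType) (x : R) :
  0 < x -> 0 < lambertW x /\ lambertW x * expR (lambertW x) = x.
Proof.
by move=> /lambertW_exists; exact: (@xgetPex _ 0 [set w : R | _ /\ _]).
Qed.

Lemma lambertW_unique (R : realType) (x w : R) :
  0 < w -> w * expR w = x -> w = lambertW x.
Proof.
move=> w0 wE; have x0 : 0 < x by rewrite -wE mulr_gt0 ?expR_gt0.
have [W0 WE] := lambertWP x0.
have mono (u v : R) : 0 < u -> u < v -> u * expR u < v * expR v.
  by move=> u0 uv; rewrite ltr_pM ?ltr_expR ?expR_ge0 // ltW.
case: (ltgtP w (lambertW x)) => // [/(mono _ _ w0)|/(mono _ _ W0)];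
  by rewrite wE WE ltxx.
Qed.

(* The set S of Stieltjes functions.  A function (0, +oo) -> R is represented
   by a total function of which only the values at x > 0 are constrained, and
   a measure on [0, +oo) by a Borel measure on R of which only the restriction
   to [0, +oo) is used. *)
Definition stieltjes_functions (R : realType) : set (R -> R) :=
  [set f | exists (a : R) (mu : {measure set (measurableTypeR R) -> \bar R}),
    [/\ 0 <= a,
        (\int[mu]_(t in `[0%R, +oo[) ((1 + t)^-1)%:E < +oo)%E &
        forall x : R, 0 < x ->
          (f x)%:E = (a%:E + \int[mu]_(t in `[0%R, +oo[) ((x + t)^-1)%:E)%E]].

(* Main.v *)
(* The function g is complete Bernstein, i.e. g(x)/x is a Stieltjes function,
   exactly when the kernels (g(x) - g(y)) / (x - y) and
   (x g(y) - y g(x)) / (x - y) are positive semidefinite on (0, oo).  By the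
   Schur product theorem this class is stable under composition, g |-> x / g,
   g |-> x g(1/x), harmonic means and limits, hence under geometric means.
   Put E = e^W, so that E ln E = x.  The kernel of E is the inverse of the
   divided difference of a ln a, which is a limit of constants minus positive
   semidefinite kernels, so its inverse is a limit of geometric series; this
   makes E and W = x / E complete Bernstein, and all the functions of the
   theorem follow by the stability properties.
   Conversely, a function with positive kernels is interpolated at finitely many
   points by a finite sum of w / (x + lam) (spectral theorem for a pair of
   matrices); an ultrafilter limit of the distribution functions of these
   discrete measures gives the representing Lebesgue-Stieltjes measure, the mass
   lost at infinity being the constant term. *)
Require Import Defs.
From HB Require Import structures.
From mathcomp Require Import all_boot all_order all_algebra.
From mathcomp Require Import complex ring lra.
From mathcomp Require Import all_classical all_reals all_analysis measurable_realfun.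
Import Order.TTheory GRing.Theory Num.Theory.
Import numFieldNormedType.Exports.

Local Open Scope classical_set_scope.
Local Open Scope ring_scope.

Set Implicit Arguments.
Unset Strict Implicit.
Unset Printing Implicit Defensive.

(** * Positive semidefinite kernels *)

(** The extremal functions x / (x + t) show where the two kernels come from: theirs are t / ((x +
    t)(y + t)) and x y / ((x + t)(y + t)), both of rank one. Kernels keep everything on the
    half-line: there is no analytic continuation, and each closure property is an identity between
    kernels. The transforms g |-> x / g and g |-> x g(1/x) merely exchange the two kernels up to
    scaling or inversion of the points, so 1 / g(x) and g(1/x) are Stieltjes functions as well as
    g(x) / x. The obstacle is (e), (j) and (k): they are differences, which in general destroy
    positivity. They rest on one further fact, that g - c stays complete Bernstein when c is the
    limit of g at 0+; it is applied to e^W and to powers of e^W and of e^W + x. *)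

Definition psd_on (R : rcfType) n (K : 'I_n -> 'I_n -> R) :=
  (forall i j, K i j = K j i) /\
  forall c : 'I_n -> R, 0 <= \sum_i \sum_j c i * c j * K i j.

Definition psd (R : rcfType) (k : R -> R -> R) :=
  forall n (x : 'I_n -> R), (forall i, 0 < x i) ->
    psd_on (fun i j => k (x i) (x j)).

Section psd_matrices.
Variable R : rcfType.

Lemma quad_sqr n (c v : 'I_n -> R) :
  \sum_i \sum_j c i * c j * (v i * v j) = (\sum_i c i * v i) ^+ 2.
Proof.
rewrite expr2 big_distrl/=; apply: eq_bigr => i _.
by rewrite big_distrr/=; apply: eq_bigr => j _; ring.
Qed.

Lemma quad_two n (K : 'I_n -> 'I_n -> R) (p q : 'I_n) (s t : R) : p != q ->
  let c i := if i == p then s else if i == q then t else 0 in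
  \sum_i \sum_j c i * c j * K i j =
  s * s * K p p + s * t * K p q + t * s * K q p + t * t * K q q.
Proof.
move=> pq c.
have E (f : 'I_n -> R) : \sum_i c i * f i = s * f p + t * f q.
  have qp : (q == p) = false by rewrite eq_sym (negbTE pq).
  rewrite (bigD1 p)//= (bigD1 q) ?qp//= /c eqxx qp eqxx.
  rewrite big1 ?addr0// => i /andP[/negbTE -> /negbTE ->].
  by rewrite mul0r.
transitivity (\sum_i c i * \sum_j c j * K i j).
  by apply: eq_bigr => i _; rewrite big_distrr/=; apply: eq_bigr => j _; ring.
by rewrite E !E; ring.
Qed.

Lemma psd_on_diag n (K : 'I_n -> 'I_n -> R) p : psd_on K -> 0 <= K p p.
Proof.
move=> [_ /(_ (fun i => (i == p)%:R))].
rewrite (bigD1 p)//= (bigD1 p)//= eqxx !mul1r !big1 ?addr0//.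
  by move=> i /negbTE ->; rewrite big1// => j _; rewrite !mul0r.
by move=> i /negbTE ->; rewrite mulr0 mul0r.
Qed.

(** Test vectors [e_p + e_q] and [e_p - e_q]. *)
Lemma psd_on_offdiag n (K : 'I_n -> 'I_n -> R) p q : psd_on K ->
  `|K p q| <= (K p p + K q q) / 2.
Proof.
move=> KP; have [->|pq] := eqVneq p q.
  by rewrite ger0_norm ?psd_on_diag//; lra.
have [KS K0] := KP.
rewrite ler_norml; apply/andP; split.
  have := K0 (fun i => if i == p then 1 else if i == q then 1 else 0).
  by rewrite quad_two// (KS q p); lra.
have := K0 (fun i => if i == p then 1 else if i == q then -1 else 0).
by rewrite quad_two// (KS q p); lra.
Qed.

Lemma psd_on_diag0 n (K : 'I_n -> 'I_n -> R) p q : psd_on K ->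
  K p p = 0 -> K p q = 0.
Proof.
move=> KP K0; have [<-//|pq] := eqVneq p q.
apply/eqP/negP => /negP Kpq; have [KS Kge0] := KP.
(* Since [K p p = 0], the form at [t e_p + e_q] is [2 t K p q + K q q]; this [t] makes it -1. *)
pose t := - (K q q + 1) / (2 * K p q).
have := Kge0 (fun i => if i == p then t else if i == q then 1 else 0).
rewrite quad_two// (KS q p) K0.
have -> : t * t * 0 + t * 1 * K p q + 1 * t * K p q + 1 * 1 * K q q = -1.
  by rewrite /t; field.
by rewrite lerNr oppr0 ler10.
Qed.

(** Cholesky factorisation, by induction on the size [p] of the leading block that supports the
    matrix. Subtracting the rank-one part of the last pivot leaves its Schur complement; a zero
    pivot forces its row to vanish. *)
Lemma psd_on_gram n (K : 'I_n -> 'I_n -> R) : psd_on K ->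
  exists V : 'I_n -> 'I_n -> R, forall i j, K i j = \sum_k V k i * V k j.
Proof.
suff gram p (L : 'I_n -> 'I_n -> R) : (p <= n)%N -> psd_on L ->
    (forall i j : 'I_n, (p <= i)%N -> L i j = 0) ->
    exists V : 'I_n -> 'I_n -> R,
      (forall i j, L i j = \sum_k V k i * V k j) /\
      forall k i : 'I_n, (p <= k)%N -> V k i = 0.
  move=> KP; have [|//||V [VE _]] := gram n K; last by exists V.
  - exact: leqnn.
  - by move=> i j; rewrite leqNgt ltn_ord.
elim: p L => [|p IH] L pn LP L0.
  exists (fun _ _ => 0); split=> // i j.
  by rewrite L0// big1// => k _; exact: mulr0.
pose P := Ordinal pn.
have LS := LP.1.
have [LPP|LPP] := eqVneq (L P P) 0.
  have [||i j|V [VE V0]] := IH L => //; first exact: ltnW.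
    rewrite leq_eqVlt => /predU1P[ip|/L0//].
    have -> : i = P by apply/val_inj.
    exact: psd_on_diag0.
  by exists V; split=> // k i pk; rewrite V0// ltnW.
have LP0 : 0 < L P P by rewrite lt_def LPP psd_on_diag.
pose L' i j := L i j - L P i * L P j / L P P.
have [|||V [VE V0]] := IH L'.
- exact: ltnW.
- split=> [i j|c]; first by rewrite /L' LS [L P i * _]mulrC.
  (* Moving the coordinate [P] of [c] by [s] minimises the form of [L]; the minimum is the form of
     the Schur complement [L'] at [c]. *)
  pose s := - (\sum_i c i * L P i) / L P P.
  have := LP.2 (fun i => c i + (i == P)%:R * s).
  have E1 (f : 'I_n -> R) :
      \sum_i (c i + (i == P)%:R * s) * f i = \sum_i c i * f i + s * f P.
    under eq_bigr do rewrite mulrDl.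
    rewrite big_split/=; congr (_ + _).
    rewrite (bigD1 P)//= eqxx mul1r big1 ?addr0// => i /negbTE ->.
    by rewrite !mul0r.
  have -> : \sum_i \sum_j (c i + (i == P)%:R * s) * (c j + (j == P)%:R * s) *
      L i j = \sum_i (c i + (i == P)%:R * s) *
      \sum_j (c j + (j == P)%:R * s) * L i j.
    apply: eq_bigr => i _; rewrite big_distrr/=; apply: eq_bigr => j _.
    by rewrite mulrA.
  rewrite E1; under eq_bigr do rewrite E1 mulrDr.
  rewrite E1 big_split/=.
  set q := \sum_i c i * \sum_j _.
  have -> : \sum_i c i * (s * L i P) = s * \sum_i c i * L P i.
    by rewrite big_distrr/=; apply: eq_bigr => i _; rewrite LS; ring.
  have -> : \sum_i \sum_j c i * c j * L' i j =
      q - (\sum_i c i * L P i) ^+ 2 / L P P.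
    rewrite -quad_sqr mulr_suml -sumrB; apply: eq_bigr => i _.
    rewrite mulr_suml big_distrr -sumrB/=; apply: eq_bigr => j _.
    by rewrite /L'; field.
  suff -> : q + s * \sum_i c i * L P i + s * (\sum_i c i * L P i + s * L P P)
    = q - (\sum_i c i * L P i) ^+ 2 / L P P by [].
  by rewrite /s; field.
- move=> i j; rewrite /L' leq_eqVlt => /predU1P[ip|pi]; last first.
    by rewrite L0// (LS P) L0// !mul0r subr0.
  by have -> : i = P by [apply/val_inj]; field.
exists (fun k i => if k == P then L P i / Num.sqrt (L P P) else V k i).
split=> [i j|k i pk]; last first.
  by rewrite ifN ?V0 1?ltnW//; apply: contraTN pk => /eqP ->; rewrite -leqNgt.
rewrite (bigD1 P)//= eqxx.
under eq_bigr => k /negbTE kP do rewrite kP.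
have -> : \sum_(k < n | k != P) V k i * V k j = L' i j.
  by rewrite VE [RHS](bigD1 P)//= !V0// mul0r add0r.
rewrite /L'; set s := Num.sqrt _.
have ss : s ^+ 2 = L P P by rewrite sqr_sqrtr// ltW.
have s0 : s != 0 by rewrite lt0r_neq0// sqrtr_gt0.
by rewrite -ss; field.
Qed.

(** A Gram factorisation of [K] turns the form of the product into a sum of forms of [L] at the
    coefficients [c i * V k i]. *)
Lemma psd_on_schur n (K L : 'I_n -> 'I_n -> R) : psd_on K ->
  psd_on L -> psd_on (fun i j => K i j * L i j).
Proof.
move=> KP LP; split=> [i j|c]; first by rewrite KP.1 LP.1.
have [V VE] := psd_on_gram KP.
have -> : \sum_i \sum_j c i * c j * (K i j * L i j) =
    \sum_k \sum_i \sum_j (c i * V k i) * (c j * V k j) * L i j.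
  rewrite [RHS]exchange_big/=; apply: eq_bigr => i _.
  rewrite [RHS]exchange_big/=; apply: eq_bigr => j _.
  by rewrite VE mulr_suml mulr_sumr; apply: eq_bigr => k _; ring.
by apply: sumr_ge0 => k _; exact: LP.2.
Qed.

End psd_matrices.

Section psd_kernels.
Variable R : realType.
Implicit Types k l : R -> R -> R.

Lemma cvg_sumr (T : Type) (F : set_system T) (FF : Filter F) n
    (f : 'I_n -> T -> R) (a : 'I_n -> R) :
  (forall i, f i x @[x --> F] --> a i) ->
  (\sum_i f i x) @[x --> F] --> \sum_i a i.
Proof. by move=> fa; apply: cvg_big => [|i _]; [exact: add_continuous|exact: fa]. Qed.

(** Compactness of the segment gives a cluster point, and an ultrafilter converges to its cluster
    points. Limits of bounded families thus exist without extracting subsequences. *)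
Lemma ultra_cvg_bounded (T : Type) (F : set_system T) (f : T -> R) a b :
  UltraFilter F -> (\forall t \near F, a <= f t <= b) ->
  f x @[x --> F] --> lim (f x @[x --> F]).
Proof.
move=> FU fab.
have [|l [_ clus_l]] := @segment_compact R a b (f x @[x --> F]) _.
  by apply: filterS fab => t; rewrite /= in_itv.
apply/cvg_ex; exists l => B Bl.
have [//|FCB] := in_ultra_setVsetC (f @^-1` B) FU.
by have [x [CBx]] := clus_l (~` B) B FCB Bl.
Qed.

Lemma psd_ext k l : (forall x y, 0 < x -> 0 < y -> k x y = l x y) ->
  psd k -> psd l.
Proof.
move=> kl kP n x x0; have [S P] := kP n x x0; split=> [i j|c].
  by rewrite -!kl// S.
have := P c; congr (_ <= _); apply: eq_bigr => i _; apply: eq_bigr => j _.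
by rewrite kl.
Qed.

Lemma psd_pair k x y : psd k -> 0 < x -> 0 < y ->
  [/\ k x y = k y x, 0 <= k x x & `|k x y| <= (k x x + k y y) / 2].
Proof.
move=> kP x0 y0; pose p (i : 'I_2) := if i == 0 then x else y.
have /kP K : forall i, 0 < p i by move=> i; rewrite /p; case: ifP.
split; first exact: (K.1 0 1); first exact: (psd_on_diag 0 K).
exact: (psd_on_offdiag 0 1 K).
Qed.

Lemma psdM k l : psd k -> psd l -> psd (fun x y => k x y * l x y).
Proof. by move=> kP lP n x x0; exact: psd_on_schur (kP n x x0) (lP n x x0). Qed.

Lemma psdD k l : psd k -> psd l -> psd (fun x y => k x y + l x y).
Proof.
move=> kP lP n x x0; have [kS k0] := kP n x x0; have [lS l0] := lP n x x0.
split=> [i j|c]; first by rewrite kS lS.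
have := addr_ge0 (k0 c) (l0 c); congr (_ <= _).
rewrite -big_split/=; apply: eq_bigr => i _; rewrite -big_split/=.
by apply: eq_bigr => j _; ring.
Qed.

Lemma psd_rank1 (f : R -> R) : psd (fun x y => f x * f y).
Proof.
move=> n x x0; split=> [i j|c]; first by rewrite mulrC.
by rewrite quad_sqr sqr_ge0.
Qed.

Lemma psd_cst (a : R) : 0 <= a -> psd (fun _ _ => a).
Proof.
move=> a0; apply: psd_ext (psd_rank1 (fun=> Num.sqrt a)) => x y _ _.
by rewrite -expr2 sqr_sqrtr.
Qed.

Lemma psd_scale (f : R -> R) k : psd k -> psd (fun x y => f x * f y * k x y).
Proof. by move=> kP; apply: psdM => //; exact: psd_rank1. Qed.

Lemma psd_comp (h : R -> R) k : (forall x : R, 0 < x -> 0 < h x) -> psd k ->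
  psd (fun x y => k (h x) (h y)).
Proof. by move=> h0 kP n x x0; apply: kP => i; exact/h0/x0. Qed.

Lemma psd_lim (T : Type) (F : set_system T) (k_ : T -> R -> R -> R) k :
  ProperFilter F -> (\forall t \near F, psd (k_ t)) ->
  (forall x y, 0 < x -> 0 < y -> k_ t x y @[t --> F] --> k x y) -> psd k.
Proof.
move=> FF kP kk n x x0; split=> [i j|c].
  apply: (@cvg_unique _ (@norm_hausdorff _ R) (k_ t (x i) (x j) @[t --> F])).
    by apply: kk; exact: x0.
  have : k_ t (x j) (x i) @[t --> F] --> k (x j) (x i) by apply: kk; exact: x0.
  apply: cvg_trans; apply: near_eq_cvg.
  by apply: filterS kP => t /(_ n x x0)[S _]; rewrite S.
have : \sum_i \sum_j c i * c j * k_ t (x i) (x j) @[t --> F] -->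
    \sum_i \sum_j c i * c j * k (x i) (x j).
  do 2 apply: cvg_sumr => ?.
  by apply: cvgM; [exact: cvg_cst|apply: kk; exact: x0].
move/cvgr_to_ge; apply; apply: filterS kP => t /(_ n x x0)[_]; exact.
Qed.

Lemma psd_geometric k : psd k ->
  (forall x y, 0 < x -> 0 < y -> `|k x y| < 1) ->
  psd (fun x y => (1 - k x y)^-1).
Proof.
move=> kP k1.
apply: (@psd_lim nat \oo (fun n x y => series (geometric 1 (k x y)) n)).
  apply: nearW => n; elim: n => [|n IH].
    apply: psd_ext (psd_cst (lexx 0)) => x y _ _.
    by rewrite /series/= big_geq.
  have kX m : psd (fun x y => k x y ^+ m).
    elim: m => [|m kX]; first exact: psd_cst.
    by apply: psd_ext (psdM kP kX) => x y _ _; rewrite exprS.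
  apply: psd_ext (psdD IH (kX n)) => x y _ _.
  by rewrite /series/= big_nat_recr//= mul1r.
by move=> x y x0 y0; rewrite -[X in _ --> X]mul1r; apply: cvg_geometric_series; exact: k1.
Qed.

(** The Cayley transform [r] has modulus below 1 and satisfies [1 - r x * r y = 2 (a x + a y) / ((1
    + a x) (1 + a y))], which reduces the claim to a geometric series. *)
Lemma psd_cauchy (a : R -> R) : (forall x : R, 0 < x -> 0 < a x) ->
  psd (fun x y => (a x + a y)^-1).
Proof.
move=> a0; pose r x := (1 - a x) / (1 + a x).
have r1 x : 0 < x -> `|r x| < 1.
  move=> /a0 ax; rewrite /r normrM normfV (ger0_norm (_ : 0 <= 1 + a x)); last lra.
  by rewrite ltr_pdivrMr ?mul1r ?ltr_norml; first apply/andP; lra.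
have rr : psd (fun x y => (1 - r x * r y)^-1).
  apply: psd_geometric; first exact: psd_rank1.
  by move=> x y /r1 rx /r1 ry; rewrite normrM mulr_ilt1.
apply: psd_ext (psdM (psd_cst (_ : 0 <= 2)) (psd_scale (fun x => (1 + a x)^-1) rr)) => //.
move=> x y /a0 ax /a0 ay; rewrite /r; field.
rewrite !andbA; apply/andP; split; [apply/andP; split|]; lra.
Qed.

End psd_kernels.

(** * Complete Bernstein functions *)

Section complete_Bernstein.
Variable R : realType.
Implicit Types (g h : R -> R) (k l : R -> R -> R).

(** Off the diagonal the second kernel is [(x g y - y g x) / (x - y)]; written through [k] it also
    makes sense on the diagonal. *)
Definition cbf_kernel g k :=
  [/\ forall x y, 0 < x -> 0 < y -> g x - g y = (x - y) * k x y,
      psd k & psd (fun x y => g y - y * k x y)].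

(* [k] is determined by [g] off the diagonal only; leaving the diagonal
   existential avoids derivatives and makes the class closed under pointwise
   limits. *)
Definition cbf g := exists k, cbf_kernel g k.

Lemma cbf_ext g h : (forall x : R, 0 < x -> g x = h x) -> cbf g -> cbf h.
Proof.
move=> gh [k [gE kP k'P]]; exists k; split => //.
  by move=> x y x0 y0; rewrite -!gh// gE.
by apply: psd_ext k'P => x y x0 y0; rewrite gh.
Qed.

(** The two positivity conditions bound the otherwise undetermined diagonal from both sides; limits
    of kernels rely on this. *)
Lemma cbf_diag g k x : cbf_kernel g k -> 0 < x -> 0 <= k x x <= g x / x.
Proof.
move=> [_ kP k'P] x0; have [_ -> _] := psd_pair kP x0 x0.
have [_ + _] := psd_pair k'P x0 x0.
by rewrite subr_ge0 mulrC -ler_pdivlMr.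
Qed.

Lemma cbf_ge0 g x : cbf g -> 0 < x -> 0 <= g x.
Proof.
move=> [k /cbf_diag gk] x0; have /andP[/le_trans/[apply]] := gk _ x0.
by rewrite pmulr_lge0 ?invr_gt0.
Qed.

Lemma cbf_cst (c : R) : 0 <= c -> cbf (fun=> c).
Proof.
move=> c0; exists (fun _ _ => 0); split.
- by move=> *; ring.
- exact: psd_cst.
- by apply: psd_ext (psd_cst c0) => x y _ _; ring.
Qed.

Lemma cbf_id : cbf id.
Proof.
exists (fun _ _ => 1); split.
- by move=> *; ring.
- exact: psd_cst.
- by apply: psd_ext (psd_cst (lexx 0)) => x y _ _ /=; ring.
Qed.

Lemma cbfD g h : cbf g -> cbf h -> cbf (fun x => g x + h x).
Proof.
move=> [k [gE kP k'P]] [l [hE lP l'P]]; exists (fun x y => k x y + l x y).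
split; last 2 first.
- exact: psdD.
- by apply: psd_ext (psdD k'P l'P) => x y _ _; ring.
move=> x y x0 y0; transitivity ((g x - g y) + (h x - h y)); first by ring.
by rewrite gE// hE//; ring.
Qed.

Lemma cbfZ (c : R) g : 0 <= c -> cbf g -> cbf (fun x => c * g x).
Proof.
move=> c0 [k [gE kP k'P]]; exists (fun x y => c * k x y); split.
- by move=> x y x0 y0; rewrite -mulrBr gE//; ring.
- exact: psdM (psd_cst c0) kP.
- by apply: psd_ext (psdM (psd_cst c0) k'P) => x y _ _; ring.
Qed.

(** The two kernels trade places: the second one scaled by [1 / g] becomes the first, and the first
    one scaled by [x / g] becomes the second. *)
Lemma cbf_div g : (forall x : R, 0 < x -> 0 < g x) -> cbf g ->
  cbf (fun x => x / g x).
Proof.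
move=> g0 [k [gE kP k'P]].
exists (fun x y => (g x)^-1 * (g y)^-1 * (g y - y * k x y)); split; last 2 first.
- exact: psd_scale.
- apply: psd_ext (psd_scale (fun x => x / g x) kP) => x y x0 y0.
  have gx := lt0r_neq0 (g0 _ x0); have gy := lt0r_neq0 (g0 _ y0).
  transitivity (y / g y - y / (g x * g y) * (g y + (x - y) * k x y - x * k x y)).
    by rewrite -gE//; field; rewrite gx gy.
  by field; rewrite gx gy.
move=> x y x0 y0.
have gx := lt0r_neq0 (g0 _ x0); have gy := lt0r_neq0 (g0 _ y0).
transitivity ((x * g y - y * g y - y * (g x - g y)) / (g x * g y)).
  by field; rewrite gx gy.
by rewrite gE//; field; rewrite gx gy.
Qed.

(** Chain rule for divided differences. The second kernel splits as
    [(g (h y) - h y * k) + k * (h y - y * l)], with [k] taken at [h x] and [h y]. *)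
Lemma cbf_kernel_comp g h k l : (forall x : R, 0 < x -> 0 < h x) ->
  cbf_kernel g k -> cbf_kernel h l ->
  cbf_kernel (fun x => g (h x)) (fun x y => k (h x) (h y) * l x y).
Proof.
move=> h0 [gE kP k'P] [hE lP l'P]; have kP' := psd_comp h0 kP; split.
- by move=> x y x0 y0; rewrite gE ?h0// hE//; ring.
- exact: psdM.
- apply: psd_ext (psdD (psd_comp h0 k'P) (psdM kP' l'P)) => x y _ _.
  by ring.
Qed.

Lemma cbf_comp g h : (forall x : R, 0 < x -> 0 < h x) -> cbf g -> cbf h ->
  cbf (fun x => g (h x)).
Proof.
move=> h0 [k gk] [l hl].
by exists (fun x y => k (h x) (h y) * l x y); exact: cbf_kernel_comp.
Qed.

(** Again the kernels trade places, now evaluated at the inverses of the points. *)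
Lemma cbf_flip g : cbf g -> cbf (fun x => x * g x^-1).
Proof.
move=> [k [gE kP k'P]].
have V0 (x : R) : 0 < x -> 0 < x^-1 by rewrite invr_gt0.
exists (fun x y => g y^-1 - y^-1 * k x^-1 y^-1); split; last 2 first.
- exact: psd_comp V0 k'P.
- apply: psd_ext (psd_comp V0 kP) => x y x0 y0.
  by field; rewrite lt0r_neq0.
move=> x y x0 y0.
have [xn yn] := (lt0r_neq0 x0, lt0r_neq0 y0).
transitivity (x * (g x^-1 - g y^-1) + (x - y) * g y^-1); first by ring.
by rewrite gE ?V0//; field; rewrite xn yn.
Qed.

(* The diagonals [k_ n x x] need not converge, but they are bounded: limits
   are taken along an ultrafilter. *)
Lemma cbf_lim (g_ : nat -> R -> R) g : (forall n, cbf (g_ n)) ->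
  (forall x : R, 0 < x -> g_ n x @[n --> \oo] --> g x) -> cbf g.
Proof.
move=> /choice[k_ gk] g_g; have [F [FU ooF]] := @ultraFilterLemma nat \oo _.
have {}g_g x : 0 < x -> g_ n x @[n --> F] --> g x.
  by move=> /g_g gx B /gx; exact: ooF.
have kxx x : 0 < x -> \forall n \near F, 0 <= k_ n x x <= (g x + 1) / x.
  move=> x0; have : \forall n \near F, g_ n x <= g x + 1.
    by move/cvgr_le: (g_g _ x0); apply; rewrite ltrDl.
  apply: filterS => n gn; have /andP[-> /le_trans] := cbf_diag (gk n) x0.
  by apply; rewrite ler_pM2r ?invr_gt0.
pose k x y := lim (k_ n x y @[n --> F]).
have k_k x y : 0 < x -> 0 < y -> k_ n x y @[n --> F] --> k x y.
  move=> x0 y0; pose M := ((g x + 1) / x + (g y + 1) / y) / 2.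
  apply: (@ultra_cvg_bounded _ _ _ _ (- M) M).
  apply: filterS2 (kxx x x0) (kxx y y0) => n /andP[_ kx] /andP[_ ky].
  rewrite -ler_norml.
  have [_ kP _] := gk n; have [_ _ /le_trans] := psd_pair kP x0 y0.
  by apply; rewrite ler_pM2r ?invr_gt0// lerD.
exists k; split.
- move=> x y x0 y0.
  have E1 : g_ n x - g_ n y @[n --> F] --> g x - g y.
    by apply: cvgB; exact: g_g.
  apply: (@cvg_unique _ (@norm_hausdorff _ R) _ _ _ _ E1).
  have -> : (fun n => g_ n x - g_ n y) = (fun n => (x - y) * k_ n x y).
    by apply/funext => n; have [-> //] := gk n.
  by apply: cvgM; [exact: cvg_cst|exact: k_k].
- by apply: psd_lim k_k; near=> n; have [] := gk n.
- apply: (@psd_lim _ _ F (fun n x y => g_ n y - y * k_ n x y)).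
    by near=> n; have [] := gk n.
  move=> x y x0 y0; apply: cvgB; first exact: g_g.
  by apply: cvgM; [exact: cvg_cst|exact: k_k].
Unshelve. all: by end_near. Qed.

End complete_Bernstein.

(** * Geometric means and powers *)

Section geometric_means.
Variable R : realType.
Implicit Types g h : R -> R.

(** The arithmetic mean conjugated by [g |-> x / g]. *)
Lemma cbf_harmonic_mean g h :
  (forall x : R, 0 < x -> 0 < g x) -> (forall x : R, 0 < x -> 0 < h x) ->
  cbf g -> cbf h -> cbf (fun x => 2 * (g x * h x) / (g x + h x)).
Proof.
move=> g0 h0 gB hB.
have mB : cbf (fun x => 2^-1 * (x / g x + x / h x)).
  by apply: cbfZ; [lra|apply: cbfD; exact: cbf_div].
apply: cbf_ext (cbf_div _ mB) => x x0; last first.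
  by rewrite mulr_gt0 ?addr_gt0 ?divr_gt0 ?g0 ?h0//; lra.
have [gx hx] := (g0 _ x0, h0 _ x0).
by field; rewrite !lt0r_neq0 ?addr_gt0 ?mulr_gt0.
Qed.

Definition heron (c : R) n (u : R) := iter n (fun u => (u + c / u) / 2) u.

Lemma heronS c n u : heron c n.+1 u = (heron c n u + c / heron c n u) / 2.
Proof. by []. Qed.

Lemma heron_gt0 c n u : 0 < c -> 0 < u -> 0 < heron c n u.
Proof.
move=> c0 u0; rewrite /heron; elim: n => [//|n IH] /=.
by rewrite divr_gt0// addr_gt0// divr_gt0.
Qed.

(** From the first step on the iterates lie above the root, and there the exact error formula
    [stepE] at least halves the error. *)
Lemma cvg_heron c u : 0 < c -> 0 < u -> heron c n u @[n --> \oo] --> Num.sqrt c.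
Proof.
move=> c0 u0; set s := Num.sqrt c.
have s0 : 0 < s by rewrite sqrtr_gt0.
have cE : c = s ^+ 2 by rewrite sqr_sqrtr// ltW.
have stepE n : heron c n.+1 u - s = (heron c n u - s) ^+ 2 / (2 * heron c n u).
  have un := lt0r_neq0 (heron_gt0 n c0 u0).
  have E v : v != 0 -> (v + s ^+ 2 / v) / 2 - s = (v - s) ^+ 2 / (2 * v).
    by move=> v0; field.
  by rewrite -E// -cE.
have ge_s n : s <= heron c n.+1 u.
  by rewrite -subr_ge0 stepE divr_ge0 ?sqr_ge0// mulr_ge0// ltW// heron_gt0.
have le n : heron c n.+1 u - s <= 2 * (heron c 1 u - s) / 2 ^+ n.+1.
  elim: n => [|n IH]; first by rewrite expr1 mulrAC divff// mul1r.
  rewrite stepE; set v := heron c n.+1 u in IH *.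
  have vs : s <= v := ge_s n.
  have v0 : 0 < v by rewrite heron_gt0.
  apply: (@le_trans _ _ ((v - s) / 2)).
    have vv : 0 < 2 * v by rewrite mulr_gt0.
    rewrite (ler_pdivrMr _ _ vv) expr2.
    have -> : (v - s) / 2 * (2 * v) = (v - s) * v by field.
    by rewrite ler_wpM2l// ?subr_ge0//; lra.
  rewrite ler_pdivrMr//; apply: le_trans IH _.
  rewrite [2 ^+ n.+2]exprS; have : 2 ^+ n.+1 != 0 :> R by rewrite expf_neq0.
  move: (2 ^+ n.+1) (heron c 1 u) => P t P0.
  by have -> : 2 * (t - s) / (2 * P) * 2 = 2 * (t - s) / P by field.
rewrite -(cvg_shiftS (fun n => heron c n u)).
apply: (@squeeze_cvgr _ _ _ _ (fun=> s)
  (fun n => s + geometric (2 * (heron c 1 u - s) / 2) 2^-1 n)).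
- apply: nearW => n; rewrite ge_s/= -lerBlDl (le_trans (le n))//.
  by rewrite exprS invfM exprVn mulrA.
- exact: cvg_cst.
rewrite -[X in _ --> X]addr0; apply: cvgD; first exact: cvg_cst.
by apply: cvg_geometric; rewrite ger0_norm//; lra.
Qed.

(* The Heron iterates of [g h] and their conjugates [g h / u] are obtained by
   taking arithmetic and harmonic means. *)
Lemma cbf_sqrtM g h :
  (forall x : R, 0 < x -> 0 < g x) -> (forall x : R, 0 < x -> 0 < h x) ->
  cbf g -> cbf h -> cbf (fun x => Num.sqrt (g x * h x)).
Proof.
move=> g0 h0 gB hB.
have c0 x : 0 < x -> 0 < g x * h x by move=> x0; rewrite mulr_gt0 ?g0 ?h0.
have u0 n x : 0 < x -> 0 < heron (g x * h x) n (g x).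
  by move=> x0; rewrite heron_gt0 ?c0 ?g0.
have v0 n x : 0 < x -> 0 < g x * h x / heron (g x * h x) n (g x).
  by move=> x0; rewrite divr_gt0 ?c0 ?u0.
apply: (@cbf_lim _ (fun n x => heron (g x * h x) n (g x))); last first.
  by move=> x x0; apply: cvg_heron; [exact: c0|exact: g0].
move=> n.
suff [] : cbf (fun x => heron (g x * h x) n (g x)) /\
  cbf (fun x => g x * h x / heron (g x * h x) n (g x)) by [].
elim: n => [|n [aB bB]].
  split => //; apply: cbf_ext hB => x x0 /=.
  by rewrite mulrAC divff ?mul1r// lt0r_neq0// g0.
split.
  apply: cbf_ext (cbfZ (_ : 0 <= 2^-1) (cbfD aB bB)) => [x x0|]; last lra.
  by rewrite mulrC.
apply: cbf_ext (cbf_harmonic_mean (u0 n) (v0 n) aB bB) => x x0.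
rewrite heronS; have := u0 n x x0; have := c0 x x0.
move: (g x * h x) (heron _ _ _) => c u cP uP.
by field; rewrite !lt0r_neq0 ?addr_gt0 ?mulr_gt0.
Qed.

(** Square roots of products give midpoints of exponents, hence all dyadic exponents; the remaining
    ones are limits. *)
Lemma cbf_geometric_mean (p : R) g h : 0 <= p <= 1 ->
  (forall x : R, 0 < x -> 0 < g x) -> (forall x : R, 0 < x -> 0 < h x) ->
  cbf g -> cbf h -> cbf (fun x => g x `^ p * h x `^ (1 - p)).
Proof.
move=> /andP[p0 p1] g0 h0 gB hB.
pose m q x := expR (q * ln (g x) + (1 - q) * ln (h x)).
have mE q x : 0 < x -> g x `^ q * h x `^ (1 - q) = m q x.
  move=> x0; rewrite /powR !gt_eqF ?g0 ?h0//= /m expRD//.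
suff mB : cbf (m p) by apply: cbf_ext mB => x x0; rewrite mE.
have dyadic n i : (i <= 2 ^ n)%N -> cbf (m (i%:R / 2 ^+ n)).
  elim: n i => [|n IH] i.
    rewrite expn0 expr0; case: i => [_|[_|//]].
      apply: cbf_ext hB => x x0; rewrite /m mulr0n !mul0r add0r subr0 mul1r lnK//.
      by rewrite posrE h0.
    apply: cbf_ext gB => x x0.
    by rewrite /m divr1 subrr mul0r addr0 mul1r lnK// posrE g0.
  move=> i2; have [i2' Ei] : (i./2 <= 2 ^ n)%N /\ i = (odd i + i./2.*2)%N.
    split; last by rewrite odd_double_half.
    rewrite -leq_double -muln2 -[(2 ^ n).*2]mul2n -expnS muln2.
    by rewrite (leq_trans _ i2)// -[leqRHS]odd_double_half leq_addl.
  (* An even numerator already occurs at level [n]. An odd one is the midpoint of [i./2] and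
     [i./2.+1] at level [n]; the latter is still at most [2 ^ n], because the odd [i] is strictly
     below [2 ^ n.+1]. *)
  case: (boolP (odd i)) => oi; last first.
    apply: cbf_ext (IH _ i2') => x x0; rewrite /m Ei (negbTE oi) add0n half_double.
    have -> : (i./2).*2%:R / 2 ^+ n.+1 = i./2%:R / 2 ^+ n :> R.
      by rewrite -muln2 natrM exprS invfM; field; rewrite expf_neq0.
    by [].
  have i3 : (i./2.+1 <= 2 ^ n)%N.
    rewrite ltn_neqAle i2' andbT; apply: contraTneq i2 => e.
    by rewrite Ei oi e -mul2n -expnS -ltnNge.
  have m0 q x : 0 < x -> 0 < m q x by move=> _; exact: expR_gt0.
  apply: cbf_ext (cbf_sqrtM (m0 _) (m0 _) (IH _ i2') (IH _ i3)) => x x0.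
  rewrite -powR12_sqrt ?mulr_ge0 ?ltW ?m0// -expRD /powR gt_eqF ?expR_gt0// expRK.
  have -> : i%:R = 1 + i./2%:R * 2 :> R.
    by rewrite {1}Ei oi natrD -muln2 natrM.
  congr expR; rewrite -[_.+1 in LHS]addn1 natrD exprS.
  by field; rewrite expf_neq0.
pose d n := (Num.truncn (p * 2 ^+ n))%:R / 2 ^+ n : R.
have p2 n : 0 <= p * 2 ^+ n by rewrite mulr_ge0// exprn_ge0.
have dp : d n @[n --> \oo] --> p.
  apply: (@squeeze_cvgr _ _ _ _ (fun n => p - geometric 1 2^-1 n) (fun=> p)).
  - apply: nearW => n; have /andP[le gt] := truncn_itv (p2 n).
    rewrite /d ler_pdivrMr ?exprn_gt0// le andbT ler_pdivlMr ?exprn_gt0//.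
    rewrite mulrBl /= mul1r exprVn mulVf ?expf_neq0// lerBlDr.
    by rewrite natr1 ltW.
  - rewrite -[X in _ --> X]subr0; apply: cvgB; first exact: cvg_cst.
    by apply: cvg_geometric; rewrite ger0_norm//; lra.
  - exact: cvg_cst.
apply: (@cbf_lim _ (fun n => m (d n))).
  move=> n; apply: dyadic; rewrite -(ler_nat R) natrX.
  have /andP[le _] := truncn_itv (p2 n); apply: (le_trans le).
  by rewrite ler_piMl// exprn_ge0.
move=> x x0; rewrite /m; apply: continuous_cvg; first exact: continuous_expR.
apply: cvgD; apply: cvgM; [exact: dp|exact: cvg_cst| |exact: cvg_cst].
by apply: cvgB; [exact: cvg_cst|exact: dp].
Qed.

Lemma cbf_powR (p : R) : 0 <= p <= 1 -> cbf (fun x : R => x `^ p).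
Proof.
move=> p01.
apply: cbf_ext (cbf_geometric_mean p01 _ _ (cbf_id R) (cbf_cst ler01)) => //.
by move=> x x0; rewrite powR1 mulr1.
Qed.

End geometric_means.

(** * The Lambert function is a complete Bernstein function *)

Section logarithmic_kernels.
Variable R : realType.

Lemma cbf_kernel_sqrt :
  cbf_kernel (@Num.sqrt R) (fun x y => (Num.sqrt x + Num.sqrt y)^-1).
Proof.
have s0 (x : R) : 0 < x -> 0 < Num.sqrt x by rewrite sqrtr_gt0.
have sE (x : R) : 0 < x -> Num.sqrt x ^+ 2 = x by move=> x0; rewrite sqr_sqrtr// ltW.
split.
- move=> x y x0 y0.
  transitivity ((Num.sqrt x ^+ 2 - Num.sqrt y ^+ 2) *
    (Num.sqrt x + Num.sqrt y)^-1); last by rewrite !sE.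
  by field; rewrite lt0r_neq0// addr_gt0 ?s0.
- exact: psd_cauchy.
- apply: psd_ext (psd_scale (@Num.sqrt R) (psd_cauchy s0)) => x y x0 y0.
  transitivity (Num.sqrt y - Num.sqrt y ^+ 2 * (Num.sqrt x + Num.sqrt y)^-1).
    by field; rewrite lt0r_neq0// addr_gt0 ?s0.
  by rewrite sE.
Qed.

(** Iterated square roots have an explicit kernel, diagonal included, whereas [cbf_powR] only
    asserts that some kernel exists. The pointwise limits leading to the logarithm need the
    diagonal. *)
Definition root2 n (x : R) := iter n (@Num.sqrt R) x.

Fixpoint root2_kernel n (x y : R) :=
  if n is m.+1 then (root2 n x + root2 n y)^-1 * root2_kernel m x y else 1.

Lemma root2_gt0 n (x : R) : 0 < x -> 0 < root2 n x.
Proof. by move=> x0; rewrite /root2; elim: n => //= n; rewrite sqrtr_gt0. Qed.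

Lemma cbf_kernel_root2 n : cbf_kernel (root2 n) (root2_kernel n).
Proof.
elim: n => [|n IH]; last exact: cbf_kernel_comp (@root2_gt0 n) cbf_kernel_sqrt IH.
split=> [x y _ _| |]; first by rewrite mulr1.
- exact: psd_cst.
- by apply: psd_ext (psd_cst (lexx 0)) => x y _ _ /=; rewrite mulr1 subrr.
Qed.

Lemma root2_kernel_diag n (x : R) : 0 < x ->
  root2_kernel n x x = root2 n x / (2 ^+ n * x).
Proof.
move=> x0; elim: n => [|n IH]; first by rewrite expr0 mul1r divff// lt0r_neq0.
have rE : root2 n x = root2 n.+1 x ^+ 2.
  by rewrite sqr_sqrtr// ltW// root2_gt0.
rewrite [LHS]/= -[Num.sqrt _]/(root2 n.+1 x) IH exprS rE.
have := root2_gt0 n.+1 x0; have : 0 < 2 ^+ n :> R by rewrite exprn_gt0.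
move: (2 ^+ n) (root2 n.+1 x) => P r P0 r0.
by field; rewrite !lt0r_neq0 ?addr_gt0.
Qed.

Lemma root2E n (x : R) : 0 < x -> root2 n x = expR (ln x / 2 ^+ n).
Proof.
move=> x0; elim: n => [|n IH]; first by rewrite expr0 divr1 lnK.
rewrite [LHS]/= -/(root2 n x) IH -powR12_sqrt ?expR_ge0//.
rewrite /powR gt_eqF ?expR_gt0// expRK; congr expR.
by rewrite exprS; field; rewrite expf_neq0.
Qed.

Lemma cvg_div_exp2 (a : R) : a / 2 ^+ n @[n --> \oo] --> (0:R).
Proof.
have -> : (fun n => a / 2 ^+ n) = geometric a 2^-1.
  by apply/funext => n; rewrite /= exprVn.
by apply: cvg_geometric; rewrite ger0_norm//; lra.
Qed.

Lemma cvg_root2 (x : R) : 0 < x -> root2 n x @[n --> \oo] --> (1:R).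
Proof.
move=> x0; rewrite (_ : (fun n => _) = (fun n => expR (ln x / 2 ^+ n))); last first.
  by apply/funext => n; rewrite root2E.
rewrite -[X in _ --> X](@expR0 R); apply: continuous_cvg (cvg_div_exp2 _).
exact: continuous_expR.
Qed.

Lemma cvg_ln_root2 (x : R) : 0 < x -> 2 ^+ n * (root2 n x - 1) @[n --> \oo] --> ln x.
Proof.
move=> x0; set a := ln x.
(* With [t = a / 2 ^+ n < 1], the bounds are [t <= expR t - 1 <= t / (1 - t)]; both come from
   [expR_ge1Dx], at [t] and at [- t]. *)
apply: (@squeeze_cvgr _ _ _ _ (fun=> a) (fun n => a * (1 - a / 2 ^+ n)^-1)).
- have a1 : \forall n \near \oo, a / 2 ^+ n < 1.
    by move/cvgr_lt: (cvg_div_exp2 a); apply.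
  apply: filterS a1 => n; rewrite root2E// -/a.
  have P0 : 0 < 2 ^+ n :> R by rewrite exprn_gt0.
  have : a = 2 ^+ n * (a / 2 ^+ n) by rewrite mulrC divfK// lt0r_neq0.
  move: (a / 2 ^+ n) => t aE t1; rewrite aE -mulrA !ler_pM2l// lerBrDl expR_ge1Dx/=.
  have t1' : 0 < 1 - t by rewrite subr_gt0.
  rewrite ler_pdivlMr// mulrBl mul1r mulrBr mulr1 lerBlDr addrA.
  rewrite -lerBlDr opprK.
  have : (1 - t) * expR t <= 1.
    by rewrite -ler_pdivlMr ?expR_gt0// mul1r -expRN expR_ge1Dx.
  lra.
- exact: cvg_cst.
- rewrite -[X in _ --> X]mulr1; apply: cvgM; first exact: cvg_cst.
  rewrite -[X in _ --> X]invr1; apply: cvgV; first exact: oner_neq0.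
  rewrite -[X in _ --> X]subr0; apply: cvgB; first exact: cvg_cst.
  exact: cvg_div_exp2.
Qed.

Definition ln_kernel (x y : R) :=
  if x == y then x^-1 else (ln x - ln y) / (x - y).

(** Divided differences ignore constants, so these are the limits of the kernels of
    [2 ^+ n * (root2 n x - 1)], which tends to [ln x]. *)
Lemma psd_ln_kernel : psd ln_kernel.
Proof.
apply: (@psd_lim _ _ \oo (fun n x y => 2 ^+ n * root2_kernel n x y)).
  apply: nearW => n; have [_ kP _] := cbf_kernel_root2 n.
  by apply: psdM kP; apply: psd_cst; rewrite exprn_ge0.
move=> x y x0 y0; rewrite /ln_kernel; case: eqVneq => [<-|xy].
  rewrite (_ : (fun n => _) = (fun n => root2 n x * x^-1)); last first.
    apply/funext => n; rewrite root2_kernel_diag//.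
    by field; rewrite lt0r_neq0 ?expf_neq0.
  rewrite -[X in _ --> X]mul1r; apply: cvgM; last exact: cvg_cst.
  exact: cvg_root2.
have xy0 : x - y != 0 by rewrite subr_eq0.
rewrite (_ : (fun n => _) = (fun n => (2 ^+ n * (root2 n x - 1) -
    2 ^+ n * (root2 n y - 1)) * (x - y)^-1)); last first.
  apply/funext => n; have [kE _ _] := cbf_kernel_root2 n.
  transitivity (2 ^+ n * (root2 n x - root2 n y) * (x - y)^-1).
    by rewrite kE//; field.
  by ring.
apply: cvgM; last exact: cvg_cst.
by apply: cvgB; exact: cvg_ln_root2.
Qed.

Definition xlnx_kernel (x y : R) :=
  if x == y then 1 + ln x else (x * ln x - y * ln y) / (x - y).

Lemma xlnx_lt (x y : R) : 1 < x -> x < y -> x * ln x < y * ln y.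
Proof.
move=> x1 xy; have x0 : 0 < x by exact: lt_trans x1.
have y0 := lt_trans x0 xy.
by rewrite ltr_pM// ?ltr_ln ?posrE// ltW// ln_gt0.
Qed.

Lemma xlnx_neq (x y : R) : 1 < x -> 1 < y -> x != y ->
  x * ln x - y * ln y != 0.
Proof.
move=> x1 y1; rewrite subr_eq0.
by case: (ltgtP x y) => // [/(xlnx_lt x1)|/(xlnx_lt y1)] xy _;
  rewrite ?(lt_eqF xy) ?(gt_eqF xy).
Qed.

(* The kernel of [a * ln a] is the limit of [2^n (1 - P_n)], with [P_n] the
   kernel of [a `^ (1 - 2^-n)]; the inverse of [1 - P_n] is a geometric
   series. *)
Lemma psd_inv_xlnx_kernel (h : R -> R) : (forall x : R, 0 < x -> 1 < h x) ->
  psd (fun x y => (xlnx_kernel (h x) (h y))^-1).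
Proof.
move=> h1; have h0 (x : R) : 0 < x -> 0 < h x by move=> /h1; exact: lt_trans.
pose P n x y := (root2 n x)^-1 * (root2 n y)^-1 *
  (root2 n y - y * root2_kernel n x y).
have PP n : psd (fun x y => P n (h x) (h y)).
  apply: (psd_comp h0); have [_ _ kP] := cbf_kernel_root2 n; exact: psd_scale.
have P2 n : 0 < 2 ^+ n :> R by rewrite exprn_gt0.
have Pdiag n x : 0 < x -> P n x x = (1 - (2 ^+ n)^-1) / root2 n x.
  move=> x0; rewrite /P root2_kernel_diag//; have r0 := root2_gt0 n x0.
  by field; rewrite !lt0r_neq0.
(* Since [h x > 1], its root is at least 1 and the diagonal of [P n] stays below 1. The off-diagonal
   entries follow by [psd_pair], so the geometric series converges. *)
have Pdiag1 n x : 0 < x -> P n (h x) (h x) < 1.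
  move=> x0; have r0 := root2_gt0 n (h0 x x0).
  rewrite Pdiag ?h0// ltr_pdivrMr// mul1r.
  apply: (@lt_le_trans _ _ 1); first by rewrite ltrBlDr ltrDl invr_gt0.
  by rewrite root2E ?h0// -expR0 ler_expR divr_ge0 ?ltW// ln_gt0// h1.
apply: (@psd_lim _ _ \oo (fun n x y => (2 ^+ n * (1 - P n (h x) (h y)))^-1)).
  apply: nearW => n.
  have G : psd (fun x y => (1 - P n (h x) (h y))^-1).
    apply: psd_geometric => // x y x0 y0.
    have [_ _ /le_lt_trans] := psd_pair (PP n) x0 y0; apply.
    by have := Pdiag1 n x x0; have := Pdiag1 n y y0; lra.
  have i0 : 0 <= (2 ^+ n)^-1 :> R by rewrite invr_ge0 ltW.
  by apply: psd_ext (psdM (psd_cst i0) G) => x y _ _; rewrite invfM.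
move=> x y /h1 + /h1; move: (h x) (h y) => {}x {}y x1 y1.
have [x0 y0] : 0 < x /\ 0 < y by split; [move: x1|move: y1]; exact: lt_trans.
have inv_root2 (z : R) : 0 < z -> 2 ^+ n * (1 - (root2 n z)^-1) @[n --> \oo] --> ln z.
  move=> z0; rewrite (_ : (fun n => _) =
      (fun n => 2 ^+ n * (root2 n z - 1) * (root2 n z)^-1)); last first.
    by apply/funext => n; field; rewrite lt0r_neq0 ?root2_gt0.
  rewrite -[X in _ --> X]mulr1; apply: cvgM; first exact: cvg_ln_root2.
  rewrite -[X in _ --> X]invr1; apply: cvgV; first exact: oner_neq0.
  exact: cvg_root2.
rewrite /xlnx_kernel; case: eqVneq => [<-|xy].
  apply: cvgV; first by rewrite lt0r_neq0// addr_gt0 ?ln_gt0.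
  rewrite (_ : (fun n => _) = (fun n => (root2 n x)^-1 +
      2 ^+ n * (1 - (root2 n x)^-1))); last first.
    by apply/funext => n; rewrite Pdiag//; field; rewrite !lt0r_neq0 ?root2_gt0.
  apply: cvgD; last exact: inv_root2.
  rewrite -[X in _ --> X]invr1; apply: cvgV; first exact: oner_neq0.
  exact: cvg_root2.
have xy0 : x - y != 0 by rewrite subr_eq0.
apply: cvgV.
  by rewrite mulf_neq0 ?invr_eq0// xlnx_neq.
rewrite (_ : (fun n => _) = (fun n => (x * (2 ^+ n * (1 - (root2 n x)^-1)) -
    y * (2 ^+ n * (1 - (root2 n y)^-1))) * (x - y)^-1)); last first.
  apply/funext => n; have [kE _ _] := cbf_kernel_root2 n.
  have [rx ry] := (lt0r_neq0 (root2_gt0 n x0), lt0r_neq0 (root2_gt0 n y0)).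
  have -> : P n x y = (x / root2 n x - y / root2 n y) / (x - y).
    rewrite /P (_ : root2_kernel n x y = (root2 n x - root2 n y) / (x - y)).
      by field; rewrite rx ry xy0.
    by rewrite kE//; field.
  by field; rewrite rx ry xy0.
apply: cvgM; last exact: cvg_cst.
by apply: cvgB; (apply: cvgM; [exact: cvg_cst|exact: inv_root2]).
Qed.

End logarithmic_kernels.

Section Lambert.
Variable R : realType.
Local Notation W := (@lambertW R).

Lemma lambertW_gt0 (x : R) : 0 < x -> 0 < W x.
Proof. by move=> /lambertWP[]. Qed.

Lemma expR_lambertW (x : R) : 0 < x -> expR (W x) = x / W x.
Proof.
move=> /lambertWP[W0 {2}<-].
by rewrite mulrAC divff ?mul1r ?lt0r_neq0.
Qed.

Lemma cbf_expR_lambertW : cbf (fun x : R => expR (W x)).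
Proof.
pose E (x : R) := expR (W x).
have E1 (x : R) : 0 < x -> 1 < E x.
  by move=> x0; rewrite -expR0 ltr_expR lambertW_gt0.
have E0 x : 0 < E x by exact: expR_gt0.
have xE x : 0 < x -> x = E x * ln (E x).
  by move=> x0; rewrite /E expRK mulrC; have [] := lambertWP x0.
exists (fun x y => (xlnx_kernel (E x) (E y))^-1).
have eqE x y : 0 < x -> 0 < y ->
    E x - E y = (x - y) * (xlnx_kernel (E x) (E y))^-1.
  move=> x0 y0; rewrite {2}(xE x)// {2}(xE y)// /xlnx_kernel.
  case: eqVneq => [->|xy]; first by rewrite !subrr mul0r.
  have d0 : E x - E y != 0 by rewrite subr_eq0.
  by rewrite invf_div mulrC divfK// xlnx_neq ?E1.
have MP := psd_inv_xlnx_kernel E1.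
split => //.
(* The second kernel of [E] factors as [E x * E y] times its first kernel times
   [ln_kernel (E x) (E y)]. *)
apply: psd_ext (psd_scale E (psdM MP (psd_comp (fun x _ => E0 x) (@psd_ln_kernel R)))).
move=> x y x0 y0.
transitivity (E y - E y * ln (E y) * (xlnx_kernel (E x) (E y))^-1); last first.
  by rewrite -xE.
rewrite /ln_kernel /xlnx_kernel; case: eqVneq => [<-|xy].
  by field; rewrite !lt0r_neq0// addr_gt0// ln_gt0// E1.
have d0 : E x - E y != 0 by rewrite subr_eq0.
have n0 := xlnx_neq (E1 x x0) (E1 y y0) xy.
by field; rewrite n0 d0.
Qed.

Lemma cbf_lambertW : cbf W.
Proof.
have E0 (x : R) : 0 < x -> 0 < expR (W x) by rewrite expR_gt0.
apply: cbf_ext (cbf_div E0 cbf_expR_lambertW) => x x0.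
rewrite expR_lambertW//; have := lambertW_gt0 x0.
by move=> W0; field; rewrite !lt0r_neq0.
Qed.

End Lambert.

(** * Subtracting the limit at zero *)

Section subtraction_of_constants.
Variable R : realType.
Implicit Types g : R -> R.

(* Adds the point [e], with weight opposite to the sum of the others, to the
   second kernel and lets [e] tend to [0]. *)
Lemma cbfB_cst g (c : R) : cbf g -> g x @[x --> 0^'+] --> c ->
  cbf (fun x => g x - c).
Proof.
move=> [k gk] gc; have [gE kP k'P] := gk; exists k; split=> //.
  by move=> x y x0 y0; rewrite -gE//; ring.
pose l x y := g y - y * k x y.
move=> n x x0; split=> [i j|a].
  have [S _] := k'P n x x0; have := S i j.
  by rewrite addrAC => ->; rewrite addrAC.
pose s := \sum_i a i.
pose Q := \sum_i \sum_j a i * a j * l (x i) (x j).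
have -> : \sum_i \sum_j a i * a j * (g (x j) - c - x j * k (x i) (x j)) =
    Q - s ^+ 2 * c.
  rewrite expr2 {1}/s mulr_suml mulr_suml -sumrB; apply: eq_bigr => i _.
  rewrite /s mulr_sumr mulr_suml -sumrB; apply: eq_bigr => j _.
  by rewrite /l; ring.
have lim_l i : l (x i) e @[e --> 0^'+] --> c.
  have xi0 := lt0r_neq0 (x0 i).
  have H : (x i * g e - e * g (x i)) * (x i - e)^-1 @[e --> 0^'+] -->
      (x i * c - 0 * g (x i)) * (x i - 0)^-1.
    have ide : e @[e --> 0^'+] --> (0 : R) by exact: cvg_at_right_filter.
    apply: cvgM.
      apply: cvgB; apply: cvgM => //; exact: cvg_cst.
    apply: cvgV; first by rewrite subr0.
    by apply: cvgB => //; exact: cvg_cst.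
  have -> : c = (x i * c - 0 * g (x i)) * (x i - 0)^-1.
    by rewrite mul0r !subr0; field.
  apply: cvg_trans H; apply: near_eq_cvg.
  near=> e.
  have e0 : 0 < e by [].
  have exi : x i - e != 0.
    by rewrite subr_eq0 gt_eqF//; near: e; exact: nbhs_right_lt.
  transitivity ((x i * g e - e * g e - e * (g (x i) - g e)) * (x i - e)^-1).
    by congr (_ * _); ring.
  by rewrite gE// /l; field.
(* This is the form at the points [x i] and [e], with weight [- s] at [e], except that [l e e] is
   replaced by [g e]. The diagonal [l e e] has no known limit, but it is at most [g e], which tends
   to [c]. *)
have H : Q - 2 * s * (\sum_i a i * l (x i) e) + s ^+ 2 * g e
    @[e --> 0^'+] --> Q - 2 * s * (\sum_i a i * c) + s ^+ 2 * c.
  apply: cvgD; last by apply: cvgM; [exact: cvg_cst|exact: gc].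
  apply: cvgB; first exact: cvg_cst.
  apply: cvgM; first exact: cvg_cst.
  by apply: cvg_sumr => i; apply: cvgM; [exact: cvg_cst|exact: lim_l].
have -> : Q - s ^+ 2 * c = Q - 2 * s * (\sum_i a i * c) + s ^+ 2 * c.
  by rewrite -mulr_suml -/s; ring.
apply: (cvgr_to_ge H); near=> e.
have e0 : 0 < e by [].
pose p (i : 'I_n.+1) := oapp x e (unlift ord0 i).
pose b (i : 'I_n.+1) := oapp a (- s) (unlift ord0 i).
have p0 i : 0 < p i by rewrite /p; case: (unlift ord0 i) => [j|]; [exact: x0|].
have [S /(_ b)] := k'P _ p p0.
have sym i : l e (x i) = l (x i) e.
  by have := S ord0 (lift ord0 i); rewrite /p liftK unlift_none.
rewrite big_ord_recl big_ord_recl /b /p unlift_none/=.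
under eq_bigr do rewrite liftK/=.
under [X in _ + X]eq_bigr => i _.
  rewrite big_ord_recl unlift_none liftK/=.
  under eq_bigr do rewrite liftK/=.
  over.
rewrite big_split/= -/(l e e).
have -> : \sum_i - s * a i * (g (x i) - x i * k e (x i)) =
    - s * \sum_i a i * l (x i) e.
  by rewrite mulr_sumr; apply: eq_bigr => i _; rewrite -/(l e (x i)) sym mulrA.
have -> : \sum_i a i * - s * (g e - e * k (x i) e) =
    - s * \sum_i a i * l (x i) e.
  by rewrite mulr_sumr; apply: eq_bigr => i _; rewrite /l; ring.
rewrite -/Q => /le_trans; apply.
have lee : l e e <= g e.
  have /andP[ke _] := cbf_diag gk e0.
  by rewrite /l gerBl mulr_ge0// ltW.
rewrite -subr_ge0.
have -> : Q - 2 * s * (\sum_i a i * l (x i) e) + s ^+ 2 * g e -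
  (- s * - s * l e e + - s * (\sum_i a i * l (x i) e) +
   (- s * (\sum_i a i * l (x i) e) + Q)) = s ^+ 2 * (g e - l e e) by ring.
by rewrite mulr_ge0 ?sqr_ge0// subr_ge0.
Unshelve. all: by end_near. Qed.

End subtraction_of_constants.

(** * Interpolation at finitely many points *)

Section finite_interpolation.
Variable R : realType.
Local Notation C := R[i].
Local Open Scope sesquilinear_scope.
Local Open Scope complex_scope.

Lemma conj_real_complex (x : R) : (x%:C : C)^*%R = x%:C.
Proof. exact: conjc_real. Qed.

Lemma hermitian_quad_ge0 n (A : 'I_n -> 'I_n -> R) (p : 'I_n -> C) :
  psd_on A -> 0 <= \sum_i \sum_j p i * (A i j)%:C * (p j)^*%R.
Proof.
move=> [AS A0]; set X := \sum_i _.
have XE : X = \sum_i \sum_j (p i)^*%R * (A i j)%:C * p j.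
  rewrite /X exchange_big/=; apply: eq_bigr => j _; apply: eq_bigr => i _.
  by rewrite (AS i j); ring.
(* Averaging with the conjugated form cancels the cross terms between real and imaginary parts. *)
have X2 : X + X = 2 * (\sum_i \sum_j complex.Re (p i) * complex.Re (p j) * A i j +
    \sum_i \sum_j complex.Im (p i) * complex.Im (p j) * A i j)%:C.
  rewrite {2}XE -big_split/= -big_split/= rmorph_sum mulr_sumr.
  apply: eq_bigr => i _; rewrite -!big_split/= rmorph_sum mulr_sumr.
  apply: eq_bigr => j _; move: (p i) (p j) (A i j) => [a b] [c d] e.
  apply/eqP; rewrite eq_complex/=.
  by apply/andP; split; apply/eqP; ring.
have : 0 <= X + X.
  by rewrite X2 mulr_ge0// ler0c addr_ge0// A0.
by rewrite -mulr2n pmulrn_lge0.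
Qed.

Lemma quad_mxE n (v : 'rV[R]_n) (M : 'M[R]_n) :
  \sum_i \sum_j v 0 i * v 0 j * M i j = (v *m M *m v^T) 0 0.
Proof.
rewrite mxE exchange_big/=; apply: eq_bigr => j _.
by rewrite !mxE mulr_suml; apply: eq_bigr => i _; rewrite mulrAC.
Qed.

(* [K = B^T B] with [B] invertible, so it suffices to diagonalize the symmetric
   matrix [B^-T L B^-1]. *)
Lemma codiagonalization n (K L : 'M[R]_n) :
  psd_on (fun i j => K i j) -> psd_on (fun i j => L i j) ->
  (forall c : 'rV_n, c *m K *m c^T = 0 -> c = 0) ->
  exists (Q : 'M[C]_n) (d : 'I_n -> R), [/\ Q \in unitmx,
    forall k, 0 <= d k, map_mx (real_complex R) K = Q^t* *m Q &
    map_mx (real_complex R) L = Q^t* *m diag_mx (\row_k (d k)%:C) *m Q].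
Proof.
move=> KP LP K0; have [V VE] := psd_on_gram KP.
pose B := \matrix_(k, i) V k i.
have KE : K = B^T *m B.
  by apply/matrixP => i j; rewrite VE mxE; apply: eq_bigr => k _; rewrite !mxE.
(* A row vector killed by [B^T] is isotropic for [K = B^T *m B], hence zero. *)
have Bu : B \in unitmx.
  rewrite -unitmx_tr -row_free_unit -kermx_eq0; apply/eqP/row_matrixP => i.
  rewrite row0; apply: K0; rewrite KE mulmxA.
  have -> : row i (kermx B^T) *m B^T = 0 by rewrite -row_mul mulmx_ker row0.
  by rewrite !mul0mx.
pose A := (invmx B)^T *m L *m invmx B.
have LE : L = B^T *m A *m B.
  by rewrite /A !mulmxA -trmx_mul mulVmx// trmx1 mul1mx mulmxKV.
have LT : L^T = L by apply/matrixP => i j; rewrite mxE LP.1.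
have AP : psd_on (fun i j => A i j).
  split=> [i j|c].
    have AT : A^T = A by rewrite /A !trmx_mul trmxK LT mulmxA.
    by rewrite -{1}AT mxE.
  pose u := (\row_i c i) *m (invmx B)^T.
  have -> : \sum_i \sum_j c i * c j * A i j = \sum_i \sum_j u 0 i * u 0 j * L i j.
    rewrite quad_mxE.
    transitivity (((\row_i c i) *m A *m (\row_i c i)^T) 0 0); last first.
      by rewrite /A /u trmx_mul trmxK !mulmxA.
    rewrite -quad_mxE; apply: eq_bigr => i _; apply: eq_bigr => j _.
    by rewrite !mxE.
  exact: LP.2.
clearbody A.
pose A' : 'M[C]_n := map_mx (real_complex R) A.
have A'real m p (M : 'M[R]_(m, p)) : (map_mx (real_complex R) M)^t* =
    map_mx (real_complex R) M^T.
  by apply/matrixP => i j; rewrite !mxE conj_real_complex.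
have A'n : A' \is normalmx.
  apply/normalmxP; rewrite /A' A'real -!map_mxM; congr map_mx.
  have -> : A^T = A by apply/matrixP => i j; rewrite mxE AP.1.
  by [].
have /orthomx_spectralP A'E := A'n.
pose P := spectralmx A'.
have Pu : P \is unitarymx := spectral_unitarymx A'.
have dE : P *m A' *m P^t* = diag_mx (spectral_diag A').
  rewrite (congr1 (fun X => P *m X *m P^t*) A'E) -/P invmx_unitary// !mulmxA.
  by rewrite mulmxtVK// (unitarymxP Pu) mul1mx.
(* The eigenvalue is the Hermitian form of [A] at row [k] of [P]. *)
have d0 k : 0 <= spectral_diag A' 0 k.
  have /matrixP/(_ k k) := dE; rewrite [RHS]mxE eqxx mulr1n => <-.
  have := hermitian_quad_ge0 (P k) AP; congr (_ <= _).
  rewrite mxE exchange_big/=; apply: eq_bigr => j _.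
  by rewrite !mxE mulr_suml; apply: eq_bigr => i _; rewrite !mxE.
exists (P *m map_mx (real_complex R) B).
exists (fun k => complex.Re (spectral_diag A' 0 k)); split.
- by rewrite unitmx_mul unitarymx_unit//= map_unitmx.
- by move=> k; have := d0 k; rewrite lecE/= => /andP[].
- rewrite KE map_mxM trmx_mul map_mxM A'real -!mulmxA; congr (_ *m _).
  rewrite mulmxA -[X in X *m _]mul1mx.
  by rewrite -invmx_unitary// mul1mx mulVmx ?mul1mx// unitarymx_unit.
- have -> : \row_k (complex.Re (spectral_diag A' 0 k))%:C = spectral_diag A'.
    by apply/rowP => k; rewrite mxE RRe_real// ger0_real.
  rewrite trmx_mul map_mxM A'real LE !map_mxM -/A'.
  rewrite (congr1 (fun X => map_mx (real_complex R) B^T *m X *m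
    map_mx (real_complex R) B) A'E) -/P invmx_unitary//.
  by rewrite !mulmxA.
Qed.

(* With [K = Q^* Q] and [L = Q^* D Q], the relation [L + K X = f 1^T], where
   [X] is the diagonal matrix of the [x j], reads [(d k + x j) Q k j = h k] with
   [f = Q^* h]. *)
Lemma finite_interpolation n (x f : 'I_n -> R) (K : 'I_n -> 'I_n -> R) :
  (forall i, 0 < x i) -> psd_on K -> psd_on (fun i j => f i - x j * K i j) ->
  (forall c : 'I_n -> R, \sum_i \sum_j c i * c j * K i j = 0 ->
     forall i, c i = 0) ->
  exists lam w : 'I_n -> R, [/\ forall k, 0 <= lam k, forall k, 0 <= w k &
    forall j, f j = \sum_k w k / (x j + lam k)].
Proof.
move=> x0 KP LP K0.
pose Km := \matrix_(i, j) K i j; pose Lm := \matrix_(i, j) (f i - x j * K i j).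
have mE (M : 'I_n -> 'I_n -> R) : psd_on M ->
    psd_on (fun i j => (\matrix_(i, j) M i j) i j).
  move=> MP; split=> [i j|c]; first by rewrite !mxE MP.1.
  have := MP.2 c; congr (_ <= _).
  by do 2 (apply: eq_bigr => ? _); rewrite mxE.
have Kdef (c : 'rV_n) : c *m Km *m c^T = 0 -> c = 0.
  move=> cKc; apply/rowP => i; rewrite mxE; apply: (K0 (fun i => c 0 i)).
  transitivity ((c *m Km *m c^T) 0 0); last by rewrite cKc mxE.
  rewrite -quad_mxE; apply: eq_bigr => j _; apply: eq_bigr => l _.
  by rewrite mxE.
have [Q [d [Qu d0 KE LE]]] := codiagonalization (mE _ KP) (mE _ LP) Kdef.
have Qtu : Q^t* \in unitmx by rewrite map_unitmx unitmx_tr.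
pose fc : 'cV[C]_n := \col_i (f i)%:C.
pose h : 'cV[C]_n := invmx (Q^t*) *m fc.
have fE : fc = Q^t* *m h by rewrite /h mulKVmx.
clearbody h.
have hE k j : Q k j = h k 0 / ((x j)%:C + (d k)%:C).
  have : diag_mx (\row_k (d k)%:C) *m Q + Q *m diag_mx (\row_j (x j)%:C) =
      h *m const_mx 1.
    apply: (can_inj (mulKmx Qtu)); rewrite mulmxDr !mulmxA -LE -KE -fE.
    apply/matrixP => i l; rewrite !mxE (bigD1 l)//= big1 => [|m ml].
      rewrite !mxE eqxx mulr1n big_ord1 !mxE mulr1 addr0 -rmorphM -rmorphD/=.
      by congr (_%:C); ring.
    by rewrite !mxE (negbTE ml) mulr0n mulr0.
  move=> /matrixP/(_ k j); rewrite !mxE.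
  rewrite (bigD1 k)//= big1 => [|m mk]; last first.
    by rewrite !mxE eq_sym (negbTE mk) mulr0n mul0r.
  rewrite (bigD1 j)//= big1 => [|m mj]; last first.
    by rewrite !mxE (negbTE mj) mulr0n mulr0.
  rewrite !mxE !eqxx !mulr1n big_ord1 !mxE mulr1 !addr0 => <-.
  have xd : (x j)%:C + (d k)%:C != 0 :> C.
    by rewrite -rmorphD/= (inj_eq (@complexI R)) lt0r_neq0// ltr_pwDl.
  by field.
(* Row [j] of [f = Q^* h] sums [(Q k j)^* h k], and [Q k j] is [h k] over a real denominator: the
   weights are the squared moduli of the [h k]. *)
exists d, (fun k => complex.Re (h k 0 * (h k 0)^*%R)); split=> // [k|j].
  by have := mul_conjC_ge0 (h k 0); rewrite lecE/= => /andP[].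
apply: (@complexI R); rewrite rmorph_sum/=.
have /matrixP/(_ j 0) := fE; rewrite mxE => ->.
rewrite mxE; apply: eq_bigr => k _.
rewrite !mxE hE [RHS]rmorphM/= RRe_real ?ger0_real ?mul_conjC_ge0//.
rewrite -rmorphD/= -fmorphV/= rmorphM/= conj_real_complex.
by rewrite mulrAC [_ * h k 0]mulrC.
Qed.

End finite_interpolation.

Section stieltjes_interpolation.
Variable R : realType.

Lemma psd_sum n (k : 'I_n -> R -> R -> R) : (forall m, psd (k m)) ->
  psd (fun x y => \sum_m k m x y).
Proof.
elim: n k => [|n IH] k kP.
  by apply: psd_ext (psd_cst (lexx 0)) => x y _ _; rewrite big_ord0.
apply: psd_ext (psdD (IH (fun m => k (widen_ord (leqnSn n) m)) _) (kP ord_max)).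
  by move=> x y _ _; rewrite big_ord_recr.
by move=> m; exact: kP.
Qed.

(** [P] is the numerator of [\sum_i c i / (x i + X)]. It has degree below [n] and vanishes at 1,
    ..., n, so it is zero; its value at [- x i] is [c i] times a nonzero product. *)
Lemma cauchy_matrix_inj n (x c : 'I_n -> R) : injective x ->
  (forall i, 0 < x i) -> (forall m : 'I_n, \sum_i c i / (x i + m.+1%:R) = 0) ->
  forall i, c i = 0.
Proof.
move=> xI x0 c0 i.
pose P := \sum_i c i *: \prod_(j < n | j != i) ('X + (x j)%:P).
have Pm (m : 'I_n) : P.[m.+1%:R] = 0.
  have D0 j : x j + m.+1%:R != 0 by rewrite lt0r_neq0// addr_gt0.
  have := congr1 (fun s => s * \prod_j (x j + m.+1%:R)) (c0 m).
  rewrite mul0r => <-; rewrite /P horner_sum mulr_suml; apply: eq_bigr => j _.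
  rewrite hornerZ horner_prod [in RHS](bigD1 j)//= mulrA divfK//; congr (_ * _).
  by apply: eq_bigr => l _; rewrite !hornerE addrC.
have P0 : P = 0.
  apply/eqP; apply: contraT => Pn0.
  have rs_uniq : uniq [seq (val m).+1%:R : R | m <- enum 'I_n].
    rewrite map_inj_uniq ?enum_uniq// => a b /eqP.
    by rewrite eqr_nat eqSS => /eqP/val_inj.
  have sz : (size P <= n)%N.
    apply: (leq_trans (size_sum _ _ _)); apply/bigmax_leqP => j _.
    apply: (leq_trans (size_scale_leq _ _)).
    rewrite (_ : \prod_(_ < n | _) _ =
        \prod_(l <- [seq l <- enum 'I_n | l != j]) ('X - (- x l)%:P)).
      rewrite size_prod_XsubC size_filter.
      have := count_predC (fun l => l != j) (enum 'I_n).
      rewrite size_enum_ord => cE; rewrite -[leqRHS]cE -addn1 leq_add2l -has_count.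
      by apply/hasP; exists j; rewrite ?mem_enum//= eqxx.
    rewrite big_filter big_enum_cond/=; apply: eq_bigr => l _.
    by rewrite polyCN opprK.
  have rsP : all (root P) [seq (val m).+1%:R : R | m <- enum 'I_n].
    by apply/allP => _ /mapP[m _ ->]; rewrite /root Pm.
  by have := max_poly_roots Pn0 rsP rs_uniq; rewrite size_map size_enum_ord ltnNge sz.
have : P.[- x i] = 0 by rewrite P0 horner0.
rewrite /P horner_sum (bigD1 i)//= [\sum_(_ < _ | _) _]big1 ?addr0.
    move/eqP; rewrite hornerZ mulf_eq0 => /orP[/eqP//|].
  rewrite horner_prod => /prodf_eq0[j ji].
  by rewrite !hornerE addrC subr_eq0 (inj_eq xI) (negbTE ji).
move=> j ji; rewrite hornerZ horner_prod (bigD1 i) 1?eq_sym//=.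
have -> : ('X + (x i)%:P).[- x i] = 0 by rewrite !hornerE addNr.
by rewrite mul0r mulr0.
Qed.

(* The divided difference of [g x / x] need not be strictly positive definite;
   adding a small multiple of [\sum_m (x + m)^-1] makes it so. *)
Lemma stieltjes_interpolation (g : R -> R) (s : seq R) (e : R) : cbf g ->
  (forall x, x \in s -> 0 < x) -> 0 < e ->
  exists l : seq (R * R), (forall p, p \in l -> 0 <= p.1 /\ 0 <= p.2) /\
    forall x, x \in s -> `|g x / x - \sum_(p <- l) p.2 / (x + p.1)| <= e.
Proof.
move=> [k [gE kP k'P]] s0 e0.
pose u := undup s; pose n := size u.
pose x (i : 'I_n) := nth 0 u i.
have xs i : x i \in s by rewrite -mem_undup mem_nth.
have x0 i : 0 < x i by exact: s0.
have xI : injective x.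
  by move=> i j /eqP; rewrite nth_uniq ?undup_uniq// => /eqP/val_inj.
(* The perturbation consists of [n] terms of size at most [d]; the successor keeps the denominator
   nonzero for an empty list. *)
pose d := e / n.+1%:R.
have d0 : 0 < d by rewrite divr_gt0.
pose r (m : 'I_n) (x : R) := (x + m.+1%:R)^-1.
have xm0 (m : 'I_n) (y : R) : 0 < y -> 0 < y + m.+1%:R by move=> y0; rewrite addr_gt0.
(* Off the diagonal, [K0] is minus the divided difference of [g x / x], and [g x / x - y * K0 x y]
   is the kernel [k] of [g]. *)
pose K0 (x y : R) := x^-1 * y^-1 * (g y - y * k x y).
pose K1 x y := \sum_m r m x * r m y.
have K0P : psd K0 by exact: psd_scale.
have K1P : psd K1 by apply: psd_sum => m; exact: psd_rank1.
pose K x y := K0 x y + d * K1 x y.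
have KP : psd K by apply: psdD => //; apply: psdM => //; apply: psd_cst; exact: ltW.
pose f x := g x / x + d * \sum_m r m x.
have K'P : psd (fun x y => f x - y * K x y).
  have LP : psd (fun x y => \sum_(m < n) m.+1%:R * (r m x * r m y)).
    by apply: psd_sum => m; apply: psdM; [exact: psd_cst|exact: psd_rank1].
  have dLP := psdM (psd_cst (ltW d0)) LP.
  apply: psd_ext (psdD kP dLP) => a b a0 b0.
  have [an bn] := (lt0r_neq0 a0, lt0r_neq0 b0).
  have -> : f a - b * K a b = (g a / a - b * K0 a b) +
      d * (\sum_m r m a - b * K1 a b) by rewrite /f /K; ring.
  congr (_ + _ * _).
    transitivity (((g a - g b) + b * k a b) / a).
      by rewrite gE//; field.
    by rewrite /K0; field; rewrite bn an.
  rewrite /K1 mulr_sumr -sumrB; apply: eq_bigr => m _; rewrite /r.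
  have := xm0 m a a0; have := xm0 m b b0; move: (m.+1%:R) => t bt at0.
  by field; rewrite !lt0r_neq0.
have [c cKc|lam [w [lam0 w0 fE]]] :=
    finite_interpolation x0 (KP n x x0) (K'P n x x0).
  apply: (cauchy_matrix_inj xI x0) => m.
  (* A null vector of [K] is null for both nonnegative summands, so every [\sum_i c i * r m (x i)]
     vanishes. *)
  have : d * (\sum_m (\sum_i c i * r m (x i)) ^+ 2) <= 0.
    have := (K0P n x x0).2 c; move: cKc.
    have -> : \sum_i \sum_j c i * c j * K (x i) (x j) =
        \sum_i \sum_j c i * c j * K0 (x i) (x j) +
        d * (\sum_m (\sum_i c i * r m (x i)) ^+ 2).
      have -> : \sum_m (\sum_i c i * r m (x i)) ^+ 2 =
          \sum_i \sum_j c i * c j * K1 (x i) (x j).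
        under eq_bigr do rewrite -quad_sqr.
        rewrite exchange_big/=; apply: eq_bigr => i _.
        rewrite exchange_big/=; apply: eq_bigr => j _.
        by rewrite /K1 mulr_sumr.
      rewrite mulr_sumr -big_split/=; apply: eq_bigr => i _.
      rewrite mulr_sumr -big_split/=; apply: eq_bigr => j _.
      by rewrite /K; ring.
    by move: (d * _) (\sum_i _) => p q; lra.
  rewrite pmulr_rle0// => sum_le0.
  have : \sum_m (\sum_i c i * r m (x i)) ^+ 2 == 0.
    by rewrite eq_le sum_le0/= sumr_ge0// => *; exact: sqr_ge0.
  rewrite psumr_eq0 => [/allP/(_ m)|*]; last exact: sqr_ge0.
  by rewrite mem_index_enum => /(_ isT); rewrite sqrf_eq0 => /eqP.
exists [seq (lam i, w i) | i <- enum 'I_n]; split.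
  by move=> _ /mapP[i _ ->]; split; [exact: lam0|exact: w0].
move=> y; rewrite -mem_undup => yu.
have yE : y = x (Ordinal (etrans (index_mem y u) yu)) by rewrite /x nth_index.
rewrite big_map big_enum/= yE -fE /f; set i := Ordinal _.
rewrite opprD addNKr normrN ger0_norm.
  have : \sum_m r m (x i) <= \sum_(m < n) 1.
    apply: ler_sum => m _; rewrite /r invf_le1 ?xm0//.
    by rewrite (le_trans _ (_ : m.+1%:R <= _)) ?ler1n// lerDr ltW.
  rewrite sumr_const card_ord => H.
  apply: (@le_trans _ _ (d * n.+1%:R)); last by rewrite /d divfK.
  by rewrite ler_pM2l// (le_trans H)// ler_nat.
by rewrite mulr_ge0 ?(ltW d0)// sumr_ge0// => m _; rewrite invr_ge0 ltW// xm0.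
Qed.

End stieltjes_interpolation.

(** * Passage to the limit *)

Section riemann_sums.
Variable R : realType.

(* Stieltjes sum of [t |-> 1 / (x + t)] against [Phi], for the nodes [i / n] with
   [0 <= i <= m] and an atom [Phi 0] at [0]. *)
Fixpoint riemann_sum n (Phi : R -> R) (x : R) m : R :=
  if m is l.+1 then riemann_sum n Phi x l +
    (Phi (m%:R / n%:R) - Phi (l%:R / n%:R)) / (x + m%:R / n%:R)
  else Phi 0 / x.

Variable H : cumulative R R.
Hypothesis H0 : forall r : R, r < 0 -> H r = 0.

Let mu : {measure set (measurableTypeR R) -> \bar R} :=
  lebesgue_stieltjes_measure H.

Lemma stieltjes_itvoc (a b : R) : a <= b -> mu `]a, b]%classic = (H b - H a)%:E.
Proof.
move=> ab; rewrite /mu/= /lebesgue_stieltjes_measure /measure_extension.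
rewrite measurable_mu_extE/=; last exact: is_ocitv.
by rewrite wlength_itv_bnd.
Qed.

(** [H] vanishes on the negatives, so the open interval from -1 to 0 is a null set, and the atom at
    0 carries the whole mass [H 0 - H (-1)] of the half-open one. *)
Lemma stieltjes_set0 : mu [set 0%R] = (H 0)%:E.
Proof.
have neg0 : mu `]-1, 0%R[%classic = 0%E.
  pose I (n : nat) : set (measurableTypeR R) := `]-1, - n.+1%:R^-1]%classic.
  have UI : \bigcup_n I n = `]-1, 0%R[%classic.
    apply/seteqP; split => x /=.
      move=> [n _]; rewrite /I/= !in_itv/= => /andP[-> /le_lt_trans]; apply.
      by rewrite oppr_lt0 invr_gt0.
    rewrite in_itv/= => /andP[x1 x0]; exists (Num.bound (- x)^-1) => //.
    have Nx0 : 0 < - x by rewrite oppr_gt0.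
    rewrite /I/= in_itv/= x1/= lerNr -[leRHS]invrK lef_pV2 ?posrE ?invr_gt0//.
    rewrite ltW// (lt_trans (archi_boundP _))// ?ltr_nat// ltW// invr_gt0//.
  have mI n : measurable (I n) by exact: measurable_itv.
  have I0 n : mu (I n) = 0%E.
    have n1 : -1 <= - n.+1%:R^-1 :> R by rewrite lerN2 invf_le1// ler1n.
    by rewrite stieltjes_itvoc// !H0 ?subrr// ?oppr_lt0 ?invr_gt0// ltrN10.
  have : (mu \o I) n @[n --> \oo] --> mu (\bigcup_n I n).
    apply: nondecreasing_cvg_mu => //; first exact: bigcup_measurable.
    move=> m n mn; apply/subsetPset/subset_itv; rewrite ?bnd_simp//.
    by rewrite lerN2 lef_pV2 ?posrE// ler_nat.
  have -> : mu \o I = cst 0%E by apply/funext => n; exact: I0.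
  rewrite UI => /(cvg_lim (@ereal_hausdorff R)) <-.
  exact: (cvg_lim (@ereal_hausdorff R) (cvg_cst _)).
have -> : mu [set 0%R] = mu `]-1, 0%R]%classic.
  have -> : `]-1, 0%R]%classic = `]-1, 0%R[%classic `|` [set 0 : R].
    by rewrite setUitv1// bnd_simp ltrN10.
  have m1 : measurable ([set 0] : set (measurableTypeR R)) by exact: measurable_set1.
  have m2 : measurable (`]-1, 0[%classic : set (measurableTypeR R)) by exact: measurable_itv.
  rewrite measureU//.
    by rewrite -[LHS]add0e; congr (_ + _)%E; exact/esym/neg0.
  by apply/seteqP; split => x //= [] + x0; rewrite x0 in_itv/= ltxx andbF.
by rewrite stieltjes_itvoc ?lerN10// (H0 (ltrN10 R)) subr0.
Qed.

Lemma measurable_cauchy (D : set (measurableTypeR R)) (x : R) :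
  measurable D -> D `<=` `[0, +oo[%classic -> 0 < x ->
  measurable_fun D (fun t : measurableTypeR R => ((x + t)^-1)%:E : \bar R).
Proof.
move=> mD D0 x0; apply/measurable_EFinP.
(* The pole at [- x] spoils monotonicity on the line; truncating [t] at 0 restores it and changes
   nothing on [D]. *)
apply: (@eq_measurable_fun _ _ _ _ _ (fun t : R => (x + Num.max t 0)^-1)).
  move=> t; rewrite inE => /D0/=; rewrite in_itv/= andbT => t0.
  by rewrite max_l.
apply: nonincreasing_measurable => // a b ab.
have m0 (c : R) : 0 < x + Num.max c 0 by rewrite ltr_pwDl// le_max lexx orbT.
rewrite lef_pV2 ?posrE ?m0// lerD2l.
by rewrite ge_max !le_max ab lexx !orbT.
Qed.

(** Each cell is evaluated at its right endpoint, where the integrand is smallest; over a width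
    [1 / n] the integrand exceeds that value by a factor of at most [1 + 1 / (n x)]. *)
Lemma riemann_sum_integral n m (x : R) : (0 < n)%N -> 0 < x ->
  ((riemann_sum n H x m)%:E <=
     \int[mu]_(t in `[0%R, (m%:R / n%:R)%R]) ((x + t)^-1)%:E)%E /\
  (\int[mu]_(t in `[0%R, (m%:R / n%:R)%R]) ((x + t)^-1)%:E <=
     ((1 + (n%:R * x)^-1) * riemann_sum n H x m)%:E)%E.
Proof.
move=> n0 x0; have n0' : 0 < n%:R :> R by rewrite ltr0n.
have nx0 : 0 < n%:R * x by rewrite mulr_gt0.
elim: m => [|m [IH1 IH2]].
  have -> : `[0%R, (0%:R / n%:R)%R]%classic = [set 0 : R].
    by rewrite mul0r set_itv1.
  have -> : (\int[mu]_(t in [set 0%R]) ((x + t)^-1)%:E = (H 0 / x)%:E)%E.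
    rewrite (_ : (\int[mu]_(t in _) _ = \int[mu]_(t in [set 0%R]) cst (x^-1)%:E t)%E).
      by rewrite integral_cst//= stieltjes_set0 -EFinM mulrC.
    by apply: eq_integral => t; rewrite inE/= => ->; rewrite addr0.
  split=> //=; rewrite lee_fin ler_peMl//.
    rewrite divr_ge0 ?(ltW x0)//; have := cumulative_is_nondecreasing H _ _ (lerN10 R).
    by rewrite [X in (X <= _)%O]H0 ?ltrN10.
  by rewrite lerDl invr_ge0 ltW.
set a := m%:R / n%:R in IH1 IH2 *; set b := m.+1%:R / n%:R.
have a0 : 0 <= a by rewrite divr_ge0.
have ab : a <= b by rewrite ler_pM2r ?invr_gt0// ler_nat.
have b0 : 0 <= b by exact: le_trans ab.
have bE : b = a + n%:R^-1 by rewrite /b -natr1 mulrDl mul1r.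
have D0 : 0 <= H b - H a by rewrite subr_ge0 (cumulative_is_nondecreasing H).
have xb0 : 0 < x + b by rewrite ltr_pwDl.
have mc : measurable_fun (`]a, b]%classic : set (measurableTypeR R))
    (fun t : measurableTypeR R => ((x + t)^-1)%:E : \bar R).
  apply: measurable_cauchy => // t /=; rewrite !in_itv/= andbT => /andP[at' _].
  by rewrite (le_trans a0)// ltW.
have cell (c : R) : (\int[mu]_(t in `]a, b]) cst c%:E t = (c * (H b - H a))%:E)%E.
  by rewrite integral_cst//= stieltjes_itvoc// EFinM.
have le1 : (((H b - H a) / (x + b))%:E <= \int[mu]_(t in `]a, b]) ((x + t)^-1)%:E)%E.
  rewrite mulrC -cell; apply: ge0_le_integral => //.
  - by move=> t _; rewrite lee_fin invr_ge0 ltW.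
  - move=> t /=; rewrite in_itv/= => /andP[at' tb]; rewrite lee_fin.
    have t0 : 0 <= t by rewrite (le_trans a0)// ltW.
    by rewrite lef_pV2 ?posrE ?ltr_pwDl// lerD2l.
have le2 : (\int[mu]_(t in `]a, b]) ((x + t)^-1)%:E <=
    ((1 + (n%:R * x)^-1) * ((H b - H a) / (x + b)))%:E)%E.
  rewrite (_ : (1 + _) * _ = (1 + (n%:R * x)^-1) / (x + b) * (H b - H a)); last by ring.
  rewrite -cell; apply: ge0_le_integral => //.
  - move=> t /=; rewrite in_itv/= => /andP[at' _]; rewrite lee_fin invr_ge0.
    by rewrite addr_ge0 ?ltW// (le_lt_trans a0).
  - move=> t /=; rewrite in_itv/= => /andP[at' tb]; rewrite lee_fin.
    have t0 : 0 <= t by rewrite (le_trans a0)// ltW.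
    have xt0 : 0 < x + t by rewrite ltr_pwDl.
    rewrite ler_pdivlMr// ler_pdivrMl// mulrDr mulr1 bE.
    have : n%:R^-1 <= (x + t) / (n%:R * x).
      rewrite invfM mulrA mulrAC ler_pMl ?invr_gt0// mulrDl divff ?lt0r_neq0//.
      by rewrite lerDl divr_ge0// ltW.
    by have := ltW at'; lra.
have -> : `[0%R, b]%classic = `[0%R, a]%classic `|` `]a, b]%classic :> set R.
  by rewrite -itv_bndbnd_setU ?bnd_simp.
have U0 : `[0%R, a]%classic `|` `]a, b]%classic `<=` (`[0, +oo[%classic : set R).
  move=> t [] /=; rewrite !in_itv/= andbT => /andP[] //.
  by move=> at' _; rewrite (le_trans a0)// ltW.
rewrite ge0_integral_setU//=; last 3 first.
- by apply: measurable_cauchy => //; exact: measurableU.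
- move=> t /U0/=; rewrite in_itv/= andbT => t0.
  by rewrite lee_fin invr_ge0 addr_ge0// ltW.
- rewrite disj_set2E; apply/eqP/seteqP; split => t //= [].
  by rewrite !in_itv/= => /andP[_ ta] /andP[/lt_le_trans/(_ ta)]; rewrite ltxx.
by split; rewrite ?mulrDr EFinD; apply: leeD.
Qed.

End riemann_sums.

Section stieltjes_integrals.
Variable R : realType.
Variable H : cumulative R R.
Hypothesis H0 : forall r : R, r < 0 -> H r = 0.

Let mu : {measure set (measurableTypeR R) -> \bar R} :=
  lebesgue_stieltjes_measure H.

(** With [n * n] cells of width [1 / n] the mesh shrinks while the range [[0, n]] grows. The bound
    [C] makes the integral finite, and the two-sided estimate then forces convergence to it. *)
Lemma cvg_riemann_sum (x C : R) : 0 < x ->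
  (forall n, (0 < n)%N -> riemann_sum n H x (n * n) <= C) ->
  exists J : R, (\int[mu]_(t in `[0%R, +oo[) ((x + t)^-1)%:E = J%:E)%E /\
    riemann_sum n H x (n * n) @[n --> \oo] --> J.
Proof.
move=> x0 SC.
pose S n := riemann_sum n H x (n * n).
pose F n : set (measurableTypeR R) := `[0%R, ((n * n)%N%:R / n%:R)%R]%classic.
pose E n := (\int[mu]_(t in F n) ((x + t)^-1)%:E)%E.
have FE n : (n * n)%N%:R / n%:R = n%:R :> R.
  case: n => [|n]; first by rewrite mul0r.
  by rewrite natrM mulfK// pnatr_eq0.
have UF : \bigcup_n F n = `[0%R, +oo[%classic.
  apply/seteqP; split => t; rewrite /= in_itv/= andbT.
    by move=> [n _]; rewrite /F/= in_itv/= => /andP[].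
  move=> t0; exists (Num.bound t) => //.
  by rewrite /F/= in_itv/= t0 FE ltW// archi_boundP.
have F0 n : F n `<=` (`[0, +oo[%classic : set R) by rewrite -UF; exact: bigcup_sup.
have mF n : measurable (F n) by exact: measurable_itv.
have ndF : nondecreasing_seq F.
  move=> m n mn; apply/subsetPset/subset_itv; rewrite ?bnd_simp// !FE.
  by rewrite ler_nat.
have f0 n (t : R) : F n t -> (0 <= ((x + t)^-1)%:E)%E.
  by move=> /F0; rewrite /= in_itv/= andbT => t0; rewrite lee_fin invr_ge0 addr_ge0// ltW.
have EJ : E n @[n --> \oo] --> (\int[mu]_(t in `[0%R, +oo[) ((x + t)^-1)%:E)%E.
  rewrite -UF; apply: ge0_nondecreasing_set_cvg_integral => //.
  by move=> n; exact: measurable_cauchy.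
have nx n : (0 < n)%N -> 0 < n%:R * x by move=> n0; rewrite mulr_gt0// ltr0n.
have SE n : (0 < n)%N -> ((S n)%:E <= E n <= ((1 + (n%:R * x)^-1) * S n)%:E)%E.
  by move=> n0; have [-> ->] := riemann_sum_integral H0 (n * n) n0 x0.
have Efin n : (0 < n)%N -> E n \is a fin_num.
  move=> /SE/andP[En1 En2]; apply/fin_numP; split.
    by move: En1; case: (E n).
  by move: En2; case: (E n).
have C0 : 0 <= C.
  have := SC 1%N isT; apply: le_trans; have /andP[_] := SE 1%N isT.
  have : (0 <= E 1%N)%E by apply: integral_ge0 => t; exact: f0.
  move=> /le_trans/[apply]; rewrite lee_fin pmulr_rge0//.
  by rewrite addr_gt0// invr_gt0 nx.
pose D := (1 + x^-1) * C.
have ED n : (0 < n)%N -> (E n <= D%:E)%E.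
  move=> n0; have /andP[_ /le_trans] := SE n n0; apply.
  have d0 : 0 < 1 + (n%:R * x)^-1 by rewrite addr_gt0// invr_gt0 nx.
  rewrite lee_fin; apply: (@le_trans _ _ ((1 + (n%:R * x)^-1) * C)).
    by rewrite ler_pM2l// SC.
  by rewrite ler_wpM2r// lerD2l lef_pV2 ?posrE ?nx// ler_peMl ?(ltW x0)// ler1n.
have near0 : \forall n \near \oo, (0 < n)%N by exact: nbhs_infty_gt.
set J := (\int[mu]_(t in _) _)%E in EJ *.
have JD : (J <= D%:E)%E.
  apply: (closed_cvg _ (@closed_ereal_ge_ereal R D%:E) _ _ EJ).
  by apply: filterS near0 => n; exact: ED.
have J0 : (0 <= J)%E.
  by apply: integral_ge0 => t; rewrite -UF => -[n _]; exact: f0.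
have Jfin : J \is a fin_num.
  by rewrite ge0_fin_numE// (le_lt_trans JD)// ltry.
exists (fine J); split; first by rewrite fineK.
have eJ : fine (E n) @[n --> \oo] --> fine J.
  by apply: fine_cvg; rewrite fineK.
apply: (@squeeze_cvgr _ _ _ _ (fun n => fine (E n) * (1 + (n%:R * x)^-1)^-1)
  (fun n => fine (E n))); last exact: eJ.
  apply: filterS near0 => n n0; have := SE n n0; rewrite -(fineK (Efin n n0)).
  rewrite !lee_fin => /andP[-> En]; rewrite andbT.
  by rewrite ler_pdivrMr ?addr_gt0 ?invr_gt0 ?nx// mulrC.
rewrite -[X in _ --> X]mulr1; apply: cvgM; first exact: eJ.
rewrite -[X in _ --> X]invr1; apply: cvgV; first exact: oner_neq0.
rewrite -[X in _ --> X]addr0; apply: cvgD; first exact: cvg_cst.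
rewrite (_ : (fun n => _) = (fun n => x^-1 * (n%:R : R)^-1)); last first.
  by apply/funext => n; rewrite invfM mulrC.
rewrite -[X in _ --> X](mulr0 x^-1); apply: cvgM; first exact: cvg_cst.
apply/gtr0_cvgV0; first by apply: filterS near0 => n; rewrite ltr0n.
exact: cvgr_idn.
Qed.

End stieltjes_integrals.

Section discrete_measures.
Variable R : realType.

Lemma ler_sum_seq (I : eqType) (l : seq I) (F G : I -> R) :
  (forall p, p \in l -> F p <= G p) -> \sum_(p <- l) F p <= \sum_(p <- l) G p.
Proof. by move=> FG; rewrite big_seq [leRHS]big_seq; exact: ler_sum. Qed.

Lemma riemann_sum_linear n (l : seq (R * R)) (Phi : R * R -> R -> R) x m :
  riemann_sum n (fun r => \sum_(p <- l) p.2 * Phi p r) x m =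
  \sum_(p <- l) p.2 * riemann_sum n (Phi p) x m.
Proof.
elim: m => [|m IH] /=.
  by rewrite mulr_suml; apply: eq_bigr => p _; rewrite mulrA.
rewrite IH -sumrB mulr_suml -big_split/=.
by apply: eq_bigr => p _; ring.
Qed.

Lemma cvg_riemann_sum_fun (T : Type) (F : set_system T) (FF : Filter F)
    (Phi_ : T -> R -> R) (Phi : R -> R) n x m :
  (forall r, Phi_ t r @[t --> F] --> Phi r) ->
  riemann_sum n (Phi_ t) x m @[t --> F] --> riemann_sum n Phi x m.
Proof.
move=> PhiF; elim: m => [|m IH] /=.
  by apply: cvgM; [exact: PhiF|exact: cvg_cst].
apply: cvgD; first exact: IH.
apply: cvgM; last exact: cvg_cst.
by apply: cvgB; exact: PhiF.
Qed.

(** Only the cell where the step jumps contributes. There [a + d < lam <= b + d] with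
    [b = a + 1 / n], so [b] is within [1 / n] of [lam]. The shift [d] is there to be sent to 0+
    later, which produces right limits. *)
Lemma riemann_sum_step n m (x d lam : R) : (0 < n)%N -> 0 < x -> 0 <= lam ->
  0 <= d -> d <= n%:R^-1 ->
  let s := riemann_sum n (fun r => (lam <= r + d)%R%:R) x m in
  if lam <= m%:R / n%:R + d
  then (`|s - (x + lam)^-1| <= (n%:R * x)^-1 / (x + lam) : Prop) else s = 0.
Proof.
move=> n0 x0 lam0 d0 dn.
have n0' : 0 < n%:R :> R by rewrite ltr0n.
have key (b : R) : 0 <= b -> `|b - lam| <= n%:R^-1 ->
    `|(x + b)^-1 - (x + lam)^-1| <= (n%:R * x)^-1 / (x + lam).
  move=> b0 blam.
  have [xb xl] : 0 < x + b /\ 0 < x + lam by rewrite !ltr_pwDl.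
  have -> : (x + b)^-1 - (x + lam)^-1 = (lam - b) / (x + b) / (x + lam).
    by field; rewrite !lt0r_neq0.
  rewrite normrM normfV (gtr0_norm xl) ler_pM2r ?invr_gt0//.
  rewrite normrM normfV (gtr0_norm xb) distrC invfM.
  apply: ler_pM; [exact: normr_ge0|by rewrite invr_ge0 ltW|exact: blam|].
  by rewrite lef_pV2 ?posrE// lerDl.
elim: m => [|m IH] /=.
  rewrite mul0r !add0r; case: ifP => lamd; last by rewrite lamd mul0r.
  rewrite lamd mul1r -{1}[x]addr0; apply: key => //.
  by rewrite sub0r normrN ger0_norm// (le_trans lamd).
set a := m%:R / n%:R in IH *; set b := m.+1%:R / n%:R.
have bE : b = a + n%:R^-1 by rewrite /b -natr1 mulrDl mul1r.
have a0 : 0 <= a by rewrite divr_ge0.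
have n0V : 0 < n%:R^-1 :> R by rewrite invr_gt0.
case lama : (lam <= a + d)%R in IH *; last rewrite IH.
  have lamb : lam <= b + d by rewrite bE; lra.
  by rewrite lamb subrr mul0r addr0.
rewrite add0r; case: ifP => lamb; last by rewrite lamb subrr mul0r.
rewrite lamb subr0 mul1r; apply: key; first by rewrite bE addr_ge0// ltW.
rewrite ler_norml; move: lama lamb => /negbT; rewrite -ltNge bE => lama lamb.
by apply/andP; split; lra.
Qed.

Lemma riemann_sum_step_le n m (x d lam : R) : (0 < n)%N -> 0 < x -> 0 <= lam ->
  0 <= d -> d <= n%:R^-1 ->
  riemann_sum n (fun r => (lam <= r + d)%R%:R) x m <=
  (1 + (n%:R * x)^-1) / (x + lam).
Proof.
move=> n0 x0 lam0 d0 dn; have /= := riemann_sum_step m n0 x0 lam0 d0 dn.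
have xl : 0 < x + lam by rewrite ltr_pwDl.
case: ifP => _; last first.
  by move=> ->; rewrite divr_ge0 ?addr_ge0 ?invr_ge0 ?mulr_ge0// ltW.
by rewrite ler_norml mulrDl mul1r => /andP[_]; rewrite lerBlDl.
Qed.

(** The first two terms serve an atom within the mesh, the last one an atom beyond it. *)
Definition mesh_error (x : R) : R := (1 + x^-1) / x + 1 + `|1 - x|.

(* Taking the difference with the value at [1] makes the mass beyond [n], which
   may escape to infinity, contribute only [O(1 / n)]. *)
Lemma riemann_sum_step_diff n (x d lam : R)
    (s := fun y => riemann_sum n (fun r => (lam <= r + d)%R%:R) y (n * n)) :
  (0 < n)%N -> 0 < x -> 0 <= lam -> 0 <= d -> d <= n%:R^-1 ->
  `|(x + lam)^-1 - (1 + lam)^-1 - (s x - s 1)| <=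
  mesh_error x / n%:R / (1 + lam).
Proof.
move=> n0 x0 lam0 d0 dn.
have n0' : 0 < n%:R :> R by rewrite ltr0n.
have [xl l1] : 0 < x + lam /\ 0 < 1 + lam by rewrite !ltr_pwDl.
have := riemann_sum_step (n * n) n0 x0 lam0 d0 dn.
have := riemann_sum_step (n * n) n0 ltr01 lam0 d0 dn.
rewrite /= -!/(s _) natrM mulfK ?lt0r_neq0// mulr1.
have xV0 : 0 < x^-1 by rewrite invr_gt0.
case lamn : (lam <= n%:R + d)%R; first move=> s1 sx.
  have -> : (x + lam)^-1 - (1 + lam)^-1 - (s x - s 1) =
    (s 1 - (1 + lam)^-1) - (s x - (x + lam)^-1) by ring.
  apply: (le_trans (ler_normB _ _)); apply: (le_trans (lerD s1 sx)).
  have c : (x + lam)^-1 <= (1 + x^-1) / (1 + lam).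
    rewrite ler_pdivlMr// ler_pdivrMl//.
    have -> : (x + lam) * (1 + x^-1) = x + lam + 1 + x^-1 * lam.
      by field; rewrite lt0r_neq0.
    have : 0 <= x^-1 * lam by rewrite mulr_ge0// ltW.
    by move: (x^-1 * lam) => u; lra.
  apply: (@le_trans _ _ (n%:R^-1 / (1 + lam) +
      (n%:R * x)^-1 * ((1 + x^-1) / (1 + lam)))).
    by rewrite lerD2l ler_pM2l// invr_gt0 mulr_gt0.
  have -> : n%:R^-1 / (1 + lam) + (n%:R * x)^-1 * ((1 + x^-1) / (1 + lam)) =
    ((1 + x^-1) / x + 1) / n%:R / (1 + lam).
    by field; rewrite !lt0r_neq0.
  by rewrite ler_pM2r ?invr_gt0// ler_pM2r ?invr_gt0// lerDl.
move=> -> ->; rewrite subrr subr0.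
have -> : (x + lam)^-1 - (1 + lam)^-1 = (1 - x) / (x + lam) / (1 + lam).
  by field; rewrite !lt0r_neq0.
rewrite normrM normfV (gtr0_norm l1) ler_pM2r ?invr_gt0//.
rewrite normrM normfV (gtr0_norm xl).
apply: (@le_trans _ _ (`|1 - x| / n%:R)).
  rewrite ler_wpM2l// lef_pV2 ?posrE//.
  by move/negbT: lamn; rewrite -ltNge => lamn; lra.
rewrite ler_pM2r ?invr_gt0// lerDr addr_ge0// divr_ge0 ?addr_ge0// ltW//.
Qed.

(* A list of pairs (location, weight) stands for a finite discrete measure. *)
Definition cauchy_sum (l : seq (R * R)) x := \sum_(p <- l) p.2 * (x + p.1)^-1.

Definition atomic_cdf (l : seq (R * R)) r := \sum_(p <- l) p.2 * (p.1 <= r)%R%:R.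

Lemma riemann_sum_cdf_diff n (l : seq (R * R)) (x d : R)
    (s := fun y => riemann_sum n (fun r => atomic_cdf l (r + d)) y (n * n)) :
  (forall p, p \in l -> 0 <= p.1 /\ 0 <= p.2) ->
  (0 < n)%N -> 0 < x -> 0 <= d -> d <= n%:R^-1 ->
  s x <= (1 + (n%:R * x)^-1) * cauchy_sum l x /\
  `|cauchy_sum l x - cauchy_sum l 1 - (s x - s 1)| <=
  mesh_error x / n%:R * cauchy_sum l 1.
Proof.
move=> l0 n0 x0 d0 dn.
pose sp (p : R * R) y := riemann_sum n (fun r => (p.1 <= r + d)%R%:R) y (n * n).
have sE y : s y = \sum_(p <- l) p.2 * sp p y by exact: riemann_sum_linear.
split.
  rewrite sE mulr_sumr; apply: ler_sum_seq => p /l0[p1 p2].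
  rewrite mulrCA ler_wpM2l//; exact: riemann_sum_step_le.
rewrite !sE -!sumrB mulr_sumr.
apply: (le_trans (ler_norm_sum _ _ _)).
apply: ler_sum_seq => p /l0[p1 p2].
rewrite -!mulrBr normrM (ger0_norm p2) [leRHS]mulrCA ler_wpM2l//.
exact: riemann_sum_step_diff.
Qed.

(** An atom at [lam <= r] satisfies [1 <= (1 + |r|) / (1 + lam)]. The total masses of the
    interpolating measures have no common bound, but their Cauchy sums at 1 do. *)
Lemma atomic_cdf_le (l : seq (R * R)) (r : R) :
  (forall p, p \in l -> 0 <= p.1 /\ 0 <= p.2) ->
  0 <= atomic_cdf l r <= (1 + `|r|) * cauchy_sum l 1.
Proof.
move=> l0; apply/andP; split.
  by rewrite /atomic_cdf big_seq sumr_ge0// => p /l0[_ p2]; rewrite mulr_ge0.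
rewrite mulr_sumr; apply: ler_sum_seq => p /l0[p1 p2].
rewrite mulrCA ler_wpM2l//; have p1' : 0 < 1 + p.1 by rewrite ltr_pwDl.
rewrite ler_pdivlMr//; case pr : (p.1 <= r)%R; last first.
  by rewrite mul0r addr_ge0.
by rewrite mul1r lerD2l (le_trans pr)// ler_norm.
Qed.

Lemma atomic_cdf_homo (l : seq (R * R)) :
  (forall p, p \in l -> 0 <= p.1 /\ 0 <= p.2) -> {homo atomic_cdf l : r s / r <= s}.
Proof.
move=> l0 r s rs; apply: ler_sum_seq => p /l0[p1 p2].
rewrite ler_wpM2l// ler_nat; case pr : (p.1 <= r)%R => //.
by rewrite (le_trans pr rs).
Qed.

Lemma atomic_cdf_lt0 (l : seq (R * R)) (r : R) :
  (forall p, p \in l -> 0 <= p.1 /\ 0 <= p.2) -> r < 0 -> atomic_cdf l r = 0.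
Proof.
move=> l0 r0; rewrite /atomic_cdf big_seq big1// => p /l0[p1 _].
by rewrite leNgt (lt_le_trans r0)// mulr0.
Qed.

End discrete_measures.

Section representation.
Variable R : realType.

Lemma ler_cvg_filter (T : Type) (F : set_system T) {FF : ProperFilter F}
    (f g : T -> R) (a b : R) : f t @[t --> F] --> a -> g t @[t --> F] --> b ->
  (\forall t \near F, f t <= g t) -> a <= b.
Proof.
move=> fa gb fg; rewrite -subr_ge0; apply: (cvgr_to_ge (cvgB gb fa)).
by apply: filterS fg => t; rewrite /= subr_ge0.
Qed.

(** A pointwise limit of distribution functions is monotone but may fail the right continuity that a
    Lebesgue-Stieltjes measure requires; taking right limits repairs this. *)
Lemma right_limit_cumulative (H0 : R -> R) : {homo H0 : r s / r <= s} ->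
  (forall r, r < 0 -> H0 r = 0) ->
  exists H : cumulative R R, (forall r, r < 0 -> H r = 0) /\
    forall r, H0 (r + d) @[d --> 0^'+] --> H r.
Proof.
move=> H0homo H0neg.
pose H r := lim (H0 s @[s --> r^'+]).
have cvgH r : H0 s @[s --> r^'+] --> H r.
  apply: nondecreasing_at_right_is_cvgr.
    by near=> s => a b _ _; exact: H0homo.
  near=> s; exists (H0 r) => _ [t /= + <-].
  by rewrite in_itv/= => /andP[rt _]; rewrite H0homo// ltW.
have leH r s : r < s -> H r <= H0 s.
  move=> rs; apply: (cvgr_to_le (cvgH r)); near=> t; apply: H0homo.
  by near: t; exact: nbhs_right_le.
have geH r : H0 r <= H r.
  by apply: (cvgr_to_ge (cvgH r)); near=> t; apply: H0homo; rewrite ltW.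
have Hnd : {homo H : r s / r <= s}.
  move=> r s; rewrite le_eqVlt => /predU1P[-> //|rs].
  by rewrite (le_trans (leH _ _ rs)).
have approx r e : 0 < e -> exists s, r < s /\ H0 s <= H r + e.
  move=> e0; have /cvgrPdist_le/(_ e e0) H0r := cvgH r.
  near (r^'+) => s; exists s; split => //.
  suff : `|H r - H0 s| <= e by rewrite ler_norml => /andP[]; lra.
  by near: s.
have Hrc : right_continuous H.
  move=> r; apply/cvgrPdist_le => e e0; have [s [rs Hs]] := approx r e e0.
  near=> t.
  have rt : r < t by [].
  have ts : t < s by near: t; exact: nbhs_right_lt.
  have := Hnd _ _ (ltW rt); have := leH _ _ ts => ts' rt'.
  by rewrite ler_norml; apply/andP; split; lra.
pose Hc : cumulative R R := HB.pack H (isCumulative.Build _ _ _ H Hnd Hrc).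
exists Hc; split => [r r0|r].
  apply/eqP; rewrite eq_le; apply/andP; split; last by rewrite -(H0neg r r0) geH.
  have r2 : r < r / 2 by lra.
  by rewrite (le_trans (leH _ _ r2))// H0neg//; lra.
apply/cvgrPdist_le => e e0; have [s [rs Hs]] := approx r e e0.
near=> d.
have d0 : 0 < d by [].
have ds : r + d <= s.
  by rewrite -lerBrDl; near: d; apply: nbhs_right_le; rewrite subr_gt0.
have rd : r < r + d by rewrite ltrDl.
have := leH _ _ rd; have := H0homo _ _ ds => ds' rd'.
by rewrite /= ler_norml; apply/andP; split; lra.
Unshelve. all: by end_near. Qed.

Lemma cbf_stieltjes (g : R -> R) : cbf g ->
  stieltjes_functions (fun x => g x / x).
Proof.
move=> gB; pose f x := g x / x.
have f0 (x : R) : 0 < x -> 0 <= f x.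
  by move=> x0; rewrite divr_ge0 ?(cbf_ge0 gB x0)// ltW.
pose T := (seq R * nat)%type.
have ex_l (t : T) : exists l : seq (R * R),
    (forall p, p \in l -> 0 <= p.1 /\ 0 <= p.2) /\
    forall x, 0 < x -> x \in t.1 -> `|f x - cauchy_sum l x| <= t.2.+1%:R^-1.
  have e0 : 0 < t.2.+1%:R^-1 :> R by rewrite invr_gt0.
  have s0 x : x \in [seq x <- t.1 | 0 < x] -> 0 < x by rewrite mem_filter => /andP[].
  have [l [l0 lf]] := stieltjes_interpolation gB s0 e0.
  by exists l; split => // x x0 xt; apply: lf; rewrite mem_filter x0.
have [l lP] := choice ex_l.
(* Indices with more points and a finer tolerance. Along an ultrafilter containing all these sets,
   interpolation becomes exact at every point. *)
pose B (b : T) : set T := [set t : T | {subset b.1 <= t.1} /\ (b.2 <= t.2)%N].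
have F0 : ProperFilter (filter_from setT B).
  apply: filter_from_proper => [|b _]; last by exists b; split.
  apply: filter_from_filter; first by exists ([::], 0%N).
  move=> a b _ _; exists (a.1 ++ b.1, maxn a.2 b.2) => // t [/= abt].
  rewrite geq_max => /andP[at2 bt2]; split; split=> // x xab; apply: abt.
    by rewrite mem_cat xab.
  by rewrite mem_cat xab orbT.
have [F [FU BF]] := ultraFilterLemma F0.
have FB b : F (B b) by apply: BF; exists b.
have lF (x : R) : 0 < x -> cauchy_sum (l t) x @[t --> F] --> f x.
  move=> x0; apply/cvgrPdist_le => e e0.
  apply: filterS (FB ([:: x], Num.bound e^-1)) => t [/= xt et].
  have [_ /(_ x x0)] := lP t; rewrite xt ?mem_head// => /(_ isT)/le_trans; apply.
  rewrite -[leRHS]invrK lef_pV2 ?posrE ?invr_gt0//.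
  rewrite ltW// (lt_le_trans (archi_boundP _)) ?invr_ge0 ?(ltW e0)//.
  by rewrite ler_nat (leq_trans et).
have l0 t : forall p, p \in l t -> 0 <= p.1 /\ 0 <= p.2 by have [] := lP t.
pose H0 r := lim (atomic_cdf (l t) r @[t --> F]).
have cvgH0 r : atomic_cdf (l t) r @[t --> F] --> H0 r.
  apply: (@ultra_cvg_bounded _ _ _ _ 0 ((1 + `|r|) * (f 1 + 1))).
  have : \forall t \near F, cauchy_sum (l t) 1 <= f 1 + 1.
    by move/cvgr_le: (lF 1 ltr01); apply; rewrite ltrDl.
  apply: filterS => t ft; have /andP[-> /le_trans] := atomic_cdf_le r (l0 t).
  by apply; rewrite ler_wpM2l// addr_ge0.
have H0homo : {homo H0 : r s / r <= s}.
  move=> r s rs; apply: (ler_cvg_filter (cvgH0 r) (cvgH0 s)).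
  by apply: nearW => t; exact: (atomic_cdf_homo (@l0 t) rs).
have H0neg r : r < 0 -> H0 r = 0.
  move=> r0; rewrite /H0 (_ : (fun t => _) = cst 0); first exact: lim_cst.
  by apply/funext => t; rewrite (atomic_cdf_lt0 (@l0 t) r0).
have [H [Hneg cvgH]] := right_limit_cumulative H0homo H0neg.
pose s n x := riemann_sum n H x (n * n).
(* Two limits in succession: along [F] at a fixed shift [d > 0], then [d] to 0+, which replaces [H0]
   by [H]. *)
have sP n (x : R) : (0 < n)%N -> 0 < x ->
    s n x <= (1 + (n%:R * x)^-1) * f x /\
    `|f x - f 1 - (s n x - s n 1)| <= mesh_error x / n%:R * f 1.
  move=> n0 x0; have nV0 : 0 < n%:R^-1 :> R by rewrite invr_gt0 ltr0n.
  pose sd d y := riemann_sum n (fun r => H0 (r + d)) y (n * n).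
  have sdP d : 0 < d -> d <= n%:R^-1 ->
      sd d x <= (1 + (n%:R * x)^-1) * f x /\
      `|f x - f 1 - (sd d x - sd d 1)| <= mesh_error x / n%:R * f 1.
    move=> d0 dn.
    pose st t y := riemann_sum n (fun r => atomic_cdf (l t) (r + d)) y (n * n).
    have stF y : st t y @[t --> F] --> sd d y.
      by apply: cvg_riemann_sum_fun => r; exact: cvgH0.
    have stP t := riemann_sum_cdf_diff (l0 t) n0 x0 (ltW d0) dn.
    split.
      have c1 : (1 + (n%:R * x)^-1) * cauchy_sum (l t) x @[t --> F] -->
          (1 + (n%:R * x)^-1) * f x.
        by apply: cvgM; [exact: cvg_cst|exact: lF].
      by apply: (ler_cvg_filter (stF x) c1); apply: nearW => t; have [] := stP t.
    have c2 : mesh_error x / n%:R * cauchy_sum (l t) 1 @[t --> F] -->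
        mesh_error x / n%:R * f 1.
      by apply: cvgM; [exact: cvg_cst|exact: lF].
    have c3 : `|cauchy_sum (l t) x - cauchy_sum (l t) 1 - (st t x - st t 1)|
        @[t --> F] --> `|f x - f 1 - (sd d x - sd d 1)|.
      apply: cvg_norm; apply: cvgB; apply: cvgB; [exact: lF|exact: lF| |]; exact: stF.
    by apply: (ler_cvg_filter c3 c2); apply: nearW => t; have [] := stP t.
  have sdF y : sd d y @[d --> 0^'+] --> s n y.
    by apply: cvg_riemann_sum_fun => r; exact: cvgH.
  have near0 : \forall d \near (0 : R)^'+, 0 < d /\ d <= n%:R^-1.
    near=> d; split => //; near: d; exact: nbhs_right_le.
  split.
    apply: (cvgr_to_le (sdF x)).
    by apply: filterS near0 => d [d0 /(sdP d d0)[]].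
  have c3 : `|f x - f 1 - (sd d x - sd d 1)| @[d --> 0^'+] -->
      `|f x - f 1 - (s n x - s n 1)|.
    apply: cvg_norm; apply: cvgB; first exact: cvg_cst.
    by apply: cvgB; exact: sdF.
  apply: (cvgr_to_le c3).
  by apply: filterS near0 => d [d0 /(sdP d d0)[]].
have cvgV : (n%:R : R)^-1 @[n --> \oo] --> 0.
  apply/gtr0_cvgV0; last exact: cvgr_idn.
  by near=> n; rewrite ltr0n; near: n; exact: nbhs_infty_gt.
have near0 : \forall n \near \oo, (0 < n)%N by exact: nbhs_infty_gt.
have bound (x : R) : 0 < x -> forall n, (0 < n)%N -> s n x <= (1 + x^-1) * f x.
  move=> x0 n n0; have [/le_trans -> //] := sP n x n0 x0.
  rewrite ler_wpM2r ?f0// lerD2l lef_pV2 ?posrE// ?mulr_gt0// ?ltr0n//.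
  by rewrite ler_peMl ?(ltW x0)// ler1n.
have [J1 [J1E J1s]] := cvg_riemann_sum Hneg ltr01 (bound 1 ltr01).
(* The limit of [sP] gives [f x - f 1 = J - J1], so [f] minus the integral is constant; its value at
   1 is nonnegative because [s n 1 <= (1 + 1 / n) f 1]. *)
exists (f 1 - J1), (lebesgue_stieltjes_measure H); split.
- rewrite subr_ge0.
  have c : (1 + (n%:R : R)^-1) * f 1 @[n --> \oo] --> f 1.
    rewrite -[X in _ --> X]mul1r; apply: cvgM; last exact: cvg_cst.
    rewrite -[X in _ --> X]addr0; apply: cvgD; [exact: cvg_cst|exact: cvgV].
  apply: (ler_cvg_filter J1s c); apply: filterS near0 => n n0.
  by have [] := sP n 1 n0 ltr01; rewrite mulr1.
- by rewrite J1E ltry.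
- move=> x x0; have [J [JE Js]] := cvg_riemann_sum Hneg x0 (bound x x0).
  rewrite JE -EFinD; congr EFin; rewrite -/(f x).
  suff : f x - f 1 - (J - J1) = 0 by lra.
  apply/eqP; rewrite -normr_le0.
  have c1 : `|f x - f 1 - (s n x - s n 1)| @[n --> \oo] --> `|f x - f 1 - (J - J1)|.
    apply: cvg_norm; apply: cvgB; first exact: cvg_cst.
    by apply: cvgB; [exact: Js|exact: J1s].
  have c2 : mesh_error x / n%:R * f 1 @[n --> \oo] --> (0 : R).
    rewrite -[X in _ --> X](mul0r (f 1)); apply: cvgM; last exact: cvg_cst.
    rewrite -[X in _ --> X](mulr0 (mesh_error x)).
    by apply: cvgM; [exact: cvg_cst|exact: cvgV].
  apply: (ler_cvg_filter c1 c2); apply: filterS near0 => n n0.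
  by have [] := sP n x n0 x0.
Unshelve. all: by end_near. Qed.

End representation.

(** * The Lambert functions *)

Section stieltjes_from_cbf.
Variable R : realType.
Local Notation S := (@stieltjes_functions R).
Local Notation W := (@lambertW R).

Lemma stieltjes_ext (f g : R -> R) : (forall x, 0 < x -> f x = g x) ->
  S f -> S g.
Proof.
move=> fg [a [mu [a0 muI fE]]]; exists a, mu; split=> // x x0.
by rewrite -fg// fE.
Qed.

Lemma cbf_inv_stieltjes (g : R -> R) : (forall x : R, 0 < x -> 0 < g x) ->
  cbf g -> S (fun x => 1 / g x).
Proof.
move=> g0 gB; apply: stieltjes_ext (cbf_stieltjes (cbf_div g0 gB)) => x x0.
by field; rewrite !lt0r_neq0 ?g0.
Qed.

Lemma cbf_flip_stieltjes (g : R -> R) : cbf g -> S (fun x => g x^-1).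
Proof.
move=> gB; apply: stieltjes_ext (cbf_stieltjes (cbf_flip gB)) => x x0.
by field; rewrite lt0r_neq0.
Qed.

Lemma powR_expR (x p : R) : 0 < x -> x `^ p = expR (p * ln x).
Proof. by move=> x0; rewrite /powR gt_eqF. Qed.

Lemma ln_lambertW (x : R) : 0 < x -> ln (W x) = ln x - W x.
Proof.
move=> x0; have [W0 {2}<-] := lambertWP x0.
by rewrite lnM ?posrE ?expR_gt0// expRK addrK.
Qed.

(** Follows from [0 < W x <= x]. The value [e = 0] serves (e) and (j); [e = 1] serves (k), where
    [e^W (1 + W) = e^W + x]. *)
Lemma cvg_expR_lambertWD (e : R) :
  0 <= e -> expR (W x) + e * x @[x --> 0^'+] --> (1 : R).
Proof.
move=> e0.
have id0 : x @[x --> 0^'+] --> (0 : R) by exact: cvg_at_right_filter.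
apply: (@squeeze_cvgr _ _ _ _ (fun=> 1) (fun x => expR x + e * x)).
- near=> x; have x0 : 0 < x by [].
  have [W0 WE] := lambertWP x0.
  have ex0 : 0 <= e * x by rewrite mulr_ge0// ltW.
  have W1 : 1 <= expR (W x) by rewrite -expR0 ler_expR ltW.
  have Wx : expR (W x) <= expR x.
    by rewrite ler_expR -{2}WE ler_peMr// ltW.
  by apply/andP; split; lra.
- exact: cvg_cst.
- rewrite -[X in _ --> X]addr0; apply: cvgD.
    rewrite -[X in _ --> X](@expR0 R); apply: continuous_cvg => //.
    exact: continuous_expR.
  by rewrite -[X in _ --> X](mulr0 e); apply: cvgM => //; exact: cvg_cst.
Unshelve. all: by end_near. Qed.

Lemma cbf_powRB1 (g : R -> R) (a : R) : 0 <= a <= 1 ->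
  (forall x : R, 0 < x -> 0 < g x) -> cbf g ->
  g x @[x --> 0^'+] --> (1 : R) -> cbf (fun x => g x `^ a - 1).
Proof.
move=> a01 g0 gB g1; apply: cbfB_cst; first exact: cbf_comp (cbf_powR a01) gB.
rewrite -[X in _ --> X](_ : expR (a * ln 1) = 1); last by rewrite ln1 mulr0 expR0.
have : expR (a * ln (g x)) @[x --> 0^'+] --> expR (a * ln 1).
  apply: continuous_cvg; first exact: continuous_expR.
  apply: cvgM; first exact: cvg_cst.
  by apply: continuous_cvg => //; apply: continuous_ln; exact: ltr01.
apply: cvg_trans; apply: near_eq_cvg; near=> x.
by rewrite /powR gt_eqF ?g0//; near: x.
Unshelve. all: by end_near. Qed.

(** Composition with [t / (1 + t)], done by hand because [g] may vanish while [cbf_comp] wants a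
    positive inner function. The second kernel is a scaling of that of [g] plus [g x * g y]. *)
Lemma cbf_div1D (g : R -> R) : cbf g -> cbf (fun x => g x / (1 + g x)).
Proof.
move=> gB; have [k [gE kP k'P]] := gB.
have g1 (x : R) : 0 < x -> 1 + g x != 0.
  by move=> /(cbf_ge0 gB) gx; rewrite lt0r_neq0// ltr_pwDl.
exists (fun x y => (1 + g x)^-1 * (1 + g y)^-1 * k x y); split.
- move=> x y x0 y0; have [gx gy] := (g1 x x0, g1 y y0).
  transitivity ((g x - g y) / ((1 + g x) * (1 + g y))).
    by field; rewrite gx gy.
  by rewrite gE//; field; rewrite gx gy.
- exact: psd_scale.
- have := psd_scale (fun x => (1 + g x)^-1) (psdD k'P (psd_rank1 g)).
  apply: psd_ext => x y x0 y0; have [gx gy] := (g1 x x0, g1 y y0).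
  by field; rewrite gx gy.
Qed.

(* [1 - g `^ (- a) = J / (1 + J)] with [J = g `^ a - 1]. *)
Lemma cbf_1B_powRN (g : R -> R) (a : R) : 0 <= a <= 1 ->
  (forall x : R, 0 < x -> 0 < g x) -> cbf g ->
  g x @[x --> 0^'+] --> (1 : R) -> cbf (fun x => 1 - g x `^ (- a)).
Proof.
move=> a01 g0 gB g1.
apply: cbf_ext (cbf_div1D (cbf_powRB1 a01 g0 gB g1)) => x x0.
have : 0 < g x `^ a by rewrite powR_gt0 ?g0.
rewrite powRN; move: (g x `^ a) => u u0.
have -> : 1 + (u - 1) = u by ring.
by field; rewrite lt0r_neq0.
Qed.

End stieltjes_from_cbf.

Theorem theorem2p4 (R : realType) :
  let S := @stieltjes_functions R in
  let W := @lambertW R in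
  (* (a) *)
  (forall c : R, 0 <= c -> S (fun x => 1 / (c + W x))) /\
  (* (b) *)
  (forall a : R, 0 <= a <= 1 -> S (fun x => W (1 / x) `^ a)) /\
  (* (c) *)
  (forall b : R, -1 <= b <= 0 -> S (fun x => x `^ b * W (1 / x) `^ b)) /\
  (* (d) *)
  (forall c : R, 0 <= c -> S (fun x => W x / (x * (c + W x)))) /\
  (* (e) *)
  S (fun x => 1 / W x - 1 / x) /\
  (* (f) *)
  (forall c b : R, 0 <= c -> -1 <= b <= 0 -> S (fun x => c + W (x `^ b))) /\
  (* (g) *)
  (forall c a : R, 0 <= c -> 0 <= a <= 1 ->
    S (fun x => 1 / (c + W (x `^ a)))) /\
  (* (h) *)
  (forall a b g : R, 0 <= a <= 1 -> -1 <= b <= 0 -> 0 <= g <= 1 ->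
    S (fun x => x `^ (a * b * g) * W (x `^ b) `^ (- (a * g))
                * (1 + W (x `^ b)) `^ (1 - g))) /\
  (* (i) *)
  (forall c a : R, 0 <= a <= 1 -> 0 <= c -> S (fun x => 1 / (c + x `^ a))) /\
  (* (j) *)
  (forall a : R, 0 <= a <= 1 -> S (fun x => 1 - x `^ a * W (1 / x) `^ a)) /\
  (* (k) *)
  (forall a b : R, 0 <= a <= 1 -> -1 <= b <= 0 ->
    S (fun x => 1 - x `^ (- (a * b)) * W (x `^ b) `^ a
                    * (1 + W (x `^ b)) `^ (- a))).
Proof.
move=> S W.
have W0 (x : R) : 0 < x -> 0 < W x by exact: lambertW_gt0.
have EW (x : R) : 0 < x -> expR (W x) = x / W x by exact: expR_lambertW.
have lnW (x : R) : 0 < x -> ln (W x) = ln x - W x by exact: ln_lambertW.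
have WB : cbf W by exact: cbf_lambertW.
have EB : cbf (fun x => expR (W x)) by exact: cbf_expR_lambertW.
have E0 (x : R) : 0 < x -> 0 < expR (W x) by rewrite expR_gt0.
have cW (c : R) : 0 <= c -> cbf (fun x => c + W x).
  by move=> c0; apply: cbfD => //; exact: cbf_cst.
have cW0 (c x : R) : 0 <= c -> 0 < x -> 0 < c + W x.
  by move=> c0 x0; rewrite ltr_wpDl// W0.
have opp01 (b : R) : -1 <= b <= 0 -> 0 <= - b <= 1.
  by move=> /andP[? ?]; apply/andP; split; lra.
have pow0 (p x : R) : 0 < x -> 0 < x `^ p by exact: powR_gt0.
have powV (p x : R) : 0 < x -> (x^-1) `^ (- p) = x `^ p.
  move=> x0; rewrite !powR_expR ?invr_gt0// lnV ?posrE//.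
  by congr expR; ring.
split.
  by move=> c c0; apply: cbf_inv_stieltjes (cW c c0) => x x0; exact: cW0.
split.
  move=> a a01.
  apply: stieltjes_ext (cbf_flip_stieltjes (cbf_comp W0 (cbf_powR a01) WB)).
  by move=> x x0; rewrite div1r.
split.
  move=> b /opp01 b01.
  (* At [y = 1 / x], [e^(W y) = y / W y], so the function is [(e^(W y))^(- b)]. *)
  apply: stieltjes_ext (cbf_flip_stieltjes (cbf_comp E0 (cbf_powR b01) EB)).
  move=> x x0; rewrite div1r; have xV0 : 0 < x^-1 by rewrite invr_gt0.
  rewrite !powR_expR ?W0 ?expR_gt0// -expRD expRK lnW// lnV ?posrE//.
  by congr expR; ring.
split.
  move=> c c0.
  have cB : cbf (fun x : R => x / (c + x)).
    apply: cbf_div => [x x0|]; first by rewrite ltr_wpDl.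
    by apply: cbfD; [exact: cbf_cst|exact: cbf_id].
  apply: stieltjes_ext (cbf_stieltjes (cbf_comp W0 cB WB)) => x x0.
  by have := cW0 c x c0 x0 => cx; field; rewrite !lt0r_neq0.
split.
  have B := cbfB_cst EB; apply: stieltjes_ext (cbf_stieltjes (B 1 _)).
    by move=> x x0; rewrite EW//; field; rewrite !lt0r_neq0 ?W0.
  have := cvg_expR_lambertWD (lexx (0 : R)).
  by under eq_fun do rewrite mul0r addr0.
split.
  move=> c b c0 /opp01 b01.
  apply: stieltjes_ext (cbf_flip_stieltjes (cbf_comp (pow0 (- b)) (cW c c0) (cbf_powR b01))).
  by move=> x x0; rewrite powV//.
split.
  move=> c a c0 a01.
  apply: (cbf_inv_stieltjes (g := fun x => c + W (x `^ a))).
    by move=> x x0; rewrite cW0// pow0.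
  exact: cbf_comp (pow0 a) (cW c c0) (cbf_powR a01).
split.
  move=> a b g a01 /opp01 b01 g01.
  have EaB := cbf_comp E0 (cbf_powR a01) EB.
  have Ea0 (x : R) : 0 < x -> 0 < expR (W x) `^ a by move=> x0; rewrite pow0 ?E0.
  (* At [y = x^b], the function is the geometric mean of [(e^(W y))^a] and [1 + W y] with weights
     [g] and [1 - g]. *)
  have gB := cbf_geometric_mean g01 Ea0 (fun x => cW0 1 x ler01) EaB (cW 1 ler01).
  apply: stieltjes_ext (cbf_flip_stieltjes (cbf_comp (pow0 (- b)) gB (cbf_powR b01))).
  move=> x x0; rewrite powV//; congr (_ * _).
  have y0 := pow0 b x x0; have w0 := W0 _ y0.
  have lny : ln (x `^ b) = b * ln x by rewrite powR_expR// expRK.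
  move: y0 w0 lny; move: (x `^ b) => y y0 w0 lny.
  rewrite !powR_expR ?expR_gt0// -expRD !expRK lnW// lny.
  by congr expR; ring.
split.
  move=> c a a01 c0; apply: (cbf_inv_stieltjes (g := fun x => c + x `^ a)).
    by move=> x x0; rewrite ltr_wpDl// pow0.
  by apply: cbfD; [exact: cbf_cst|exact: cbf_powR].
split.
  move=> a a01.
  (* At [y = 1 / x], [x W(1/x) = e^(- W y)], so the function is [1 - (e^(W y))^(- a)]. *)
  have := cvg_expR_lambertWD (lexx (0 : R)).
  under eq_fun do rewrite mul0r addr0.
  move=> /(cbf_1B_powRN a01 E0 EB)/cbf_flip_stieltjes; apply: stieltjes_ext => x x0.
  rewrite div1r; have xV0 : 0 < x^-1 by rewrite invr_gt0.
  rewrite !powR_expR ?W0 ?expR_gt0// -expRD expRK lnW// lnV ?posrE//.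
  by congr (_ - expR _); ring.
move=> a b a01 /opp01 b01.
(* At [y = x^b], the subtracted term is [(e^(W y) (1 + W y))^(- a)], whose base equals
   [e^(W y) + y]. *)
have FB : cbf (fun x => expR (W x) + 1 * x).
  by apply: cbfD => //; apply: cbfZ => //; exact: cbf_id.
have F0 (x : R) : 0 < x -> 0 < expR (W x) + 1 * x.
  by move=> x0; rewrite addr_gt0 ?E0// mul1r.
have HB := cbf_1B_powRN a01 F0 FB (cvg_expR_lambertWD ler01).
apply: stieltjes_ext (cbf_flip_stieltjes (cbf_comp (pow0 (- b)) HB (cbf_powR b01))).
move=> x x0; rewrite powV//; congr (_ - _).
have y0 := pow0 b x x0; have w0 := W0 _ y0.
have w1 : 0 < 1 + W (x `^ b) by rewrite addr_gt0.
have -> : expR (W (x `^ b)) + 1 * x `^ b = expR (W (x `^ b)) * (1 + W (x `^ b)).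
  by rewrite EW//; field; rewrite lt0r_neq0.
have lny : ln (x `^ b) = b * ln x by rewrite powR_expR// expRK.
move: y0 w0 w1 lny; move: (x `^ b) => y y0 w0 w1 lny.
rewrite !powR_expR ?mulr_gt0 ?expR_gt0// -!expRD.
rewrite lnM ?posrE ?expR_gt0// !expRK lnW// lny.
by congr expR; ring.
Qed.
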